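(* Let $\phi:\mathbb{R}\to\mathbb{R}$ be a homeomorphism such that $\phi(x+2\pi)=\phi(x)+2\pi$ and $x\le\phi(x)<x+\pi$ for all $x\in\mathbb{R}$. Then the category $\mathcal{F}_\phi$ is a Frobenius category, whose indecomposable projective-injective objects are, up to isomorphism, the objects $E(x,y)$ where either $y=\phi(x)$ or $x+2\pi=\phi(y)$.
   Context: $R$ is a discrete valuation ring with uniformizing parameter $t$ and valuation $\nu$. $S^1=\mathbb{R}/2\pi\mathbb{Z}$, and for $x\in\mathbb{R}$ the class of $x$ in $S^1$ is $[x]$. A representation $V$ of $S^1$ over $R$ consists of an $R$-module $V[x]$ for every $[x]\in S^1$ and an $R$-linear map $V^{(x,\alpha)}:V[x]\to V[x-\alpha]$ for every $[x]\in S^1$ and real $\alpha\ge 0$ (depending only on $[x]$ and $\alpha$), such that $V^{(x-\beta,\alpha)}\circ V^{(x,\beta)}=V^{(x,\alpha+\beta)}$ for all $\alpha,\beta\ge 0$, and $V^{(x,2\pi n)}:V[x]\to V[x]$ is multiplication by $t^n$ for all $n\in\mathbb{N}$. A morphism $f:V\to W$ is a family of $R$-linear maps $f_{[x]}:V[x]\to W[x]$ with $W^{(x,\alpha)}f_{[x]}=f_{[x-\alpha]}V^{(x,\alpha)}$. Monomorphisms, epimorphisms, exactness and direct sums are taken pointwise; a representation is projective if morphisms from it lift through all epimorphisms. $P_{[x]}$ is the representation with $P_{[x]}[x-\alpha]=Re_x^\alpha$ free on one generator $e_x^\alpha$ for $0\le\alpha<2\pi$; for $n\in\mathbb{N}$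 put $e_x^{\gamma+2\pi n}:=t^ne_x^\gamma$; write $e_x=e_x^0$; the structure maps are $P_{[x]}^{(x-\alpha,\beta)}(e_x^\alpha)=e_x^{\alpha+\beta}$. A representation is finitely generated if it is a quotient of a finite direct sum of representations $P_{[x_i]}$. $\mathcal{P}_{S^1}$ is the category of all finitely generated projective representations of $S^1$ over $R$; every object of it is isomorphic to a finite direct sum $\bigoplus P_{[x_i]}$. The category $\mathcal{F}_\pi$: objects are pairs $(V,d)$ with $V\in\mathcal{P}_{S^1}$ and $d:V\to V$ an endomorphism with $d^2=t$ (multiplication by $t$); morphisms $(V,d)\to(W,d)$ are morphisms $f:V\to W$ with $fd=df$. Exact sequences in $\mathcal{F}_\pi$ are the sequences $(X,d)\xrightarrow{f}(Y,d)\xrightarrow{g}(Z,d)$ such that $0\to X\xrightarrow{f}Y\xrightarrow{g}Z\to 0$ is exact (hence split exact) in $\mathcal{P}_{S^1}$. For real numbers $x\le y\le x+2\pi$ put $\alpha=y-x$, $\beta=x+2\pi-y$ and $E(x,y)=\left(P_{[x]}\oplus P_{[y]},\ d=\begin{bmatrix}0&\beta_*\\ \alpha_*&0\end{bmatrix}\right)\in\mathcal{F}_\pi$, where $\alpha_*(e_x)=e_y^\alpha$ and $\beta_*(e_y)=e_x^\beta$. Depth: for nonzero $f:P_{[x]}\to P_{[y]}$, the depth $\delta(f)$ is the unique real $\alpha\ge0$ with $f(e_x)=ue_y^\alpha$ for a unit $u\in R$; $\delta(0)=\infty$. Support intervals: a closed interval in $S^1$ is the image $[x,y]$ of a real interval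 with $x\le y<x+2\pi$. Let $f:P\to Q$ be a morphism in $\mathcal{P}_{S^1}$ with decompositions $P=\bigoplus P_{[x_i]}$, $Q=\bigoplus P_{[y_j]}$ and components $f_{ji}:P_{[x_i]}\to P_{[y_j]}$. Consider all closed intervals $[x_i,y_j]\subsetneq S^1$ (representatives chosen with $x_i\le y_j<x_i+2\pi$) such that $\delta(f_{ji})=y_j-x_i$. The minimal elements of this collection under inclusion are the support intervals of $f$ (they do not depend on the decompositions). $\mathcal{F}_\phi$ is the full subcategory of $\mathcal{F}_\pi$ consisting of all $(V,d)$ such that every support interval $[x,y]$ of $d$ contains an interval of the form $[z,\phi(z)]$. Its exact sequences are the exact sequences of $\mathcal{F}_\pi$ with all terms in $\mathcal{F}_\phi$. *)

(* Defs.v *)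
From HB Require Import structures.
From mathcomp Require Import all_boot all_order all_algebra generic_quotient.
From mathcomp Require Import archimedean.
From mathcomp Require Import boolp classical_sets reals topology trigo.
From mathcomp Require Import ring lra.

Set Implicit Arguments.
Unset Strict Implicit.
Unset Printing Implicit Defensive.

Import Order.TTheory GRing.Theory Num.Theory.
Local Open Scope classical_set_scope.
Local Open Scope ring_scope.

Section DVR.
Context (R : idomainType).

Definition is_ideal (I : set R) : Prop :=
  [/\ I 0, (forall a b, I a -> I b -> I (a + b)) & (forall r a, I a -> I (r * a))].

Definition principal_ideal (a : R) : set R := [set r * a | r in setT].

Definition is_maximal_ideal (I : set R) : Prop :=
  [/\ is_ideal I, ~ I 1
    & forall J : set R, is_ideal J -> ~ J 1 -> I `<=` J -> J `<=` I].

Definition is_dvr : Prop :=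
  [/\ (forall I : set R, is_ideal I -> exists a, I = principal_ideal a),
      (exists I, is_maximal_ideal I /\
                 forall J, is_maximal_ideal J -> J = I)
    & (exists a : R, a != 0 /\ a \isn't a GRing.unit)].

Definition is_uniformizer (t : R) : Prop := is_maximal_ideal (principal_ideal t).

End DVR.

Definition homeomorphism (S T : topologicalType) (f : S -> T) : Prop :=
  continuous f /\
  exists g : T -> S, [/\ continuous g, cancel f g & cancel g f].

Record preadditive := Preadditive {
  obj :> Type;
  hom : obj -> obj -> zmodType;
  idm : forall A, hom A A;
  comp : forall A B C, hom B C -> hom A B -> hom A C;
  compA : forall A B C D (h : hom C D) (g : hom B C) (f : hom A B),
    comp h (comp g f) = comp (comp h g) f;
  comp1m : forall A B (f : hom A B), comp (idm B) f = f;
  compm1 : forall A B (f : hom A B), comp f (idm A) = f;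
  compDl : forall A B C (g h : hom B C) (f : hom A B),
    comp (g + h) f = comp g f + comp h f;
  compDr : forall A B C (g : hom B C) (f h : hom A B),
    comp g (f + h) = comp g f + comp g h }.

Arguments idm {p} A.

Section Category.
Context (C : preadditive).

Definition is_iso (A B : C) (f : hom A B) : Prop :=
  exists g : hom B A, comp g f = idm A /\ comp f g = idm B.

Definition isomorphic (A B : C) : Prop := exists f : hom A B, is_iso f.

Definition is_zero (A : C) : Prop := idm A = 0.

Definition is_biproduct (S A B : C) : Prop :=
  exists (i1 : hom A S) (i2 : hom B S) (p1 : hom S A) (p2 : hom S B),
    [/\ comp p1 i1 = idm A, comp p2 i2 = idm B, comp p1 i2 = 0, comp p2 i1 = 0
      & comp i1 p1 + comp i2 p2 = idm S].

Definition additive_category : Prop :=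
  (exists Z : C, is_zero Z) /\ forall A B : C, exists S, is_biproduct S A B.

Definition indecomposable (X : C) : Prop :=
  ~ is_zero X /\ forall A B, is_biproduct X A B -> is_zero A \/ is_zero B.

Definition is_kernel (A B D : C) (i : hom A B) (p : hom B D) : Prop :=
  comp p i = 0 /\
  forall T (h : hom T B), comp p h = 0 -> exists! k : hom T A, comp i k = h.

Definition is_cokernel (A B D : C) (i : hom A B) (p : hom B D) : Prop :=
  comp p i = 0 /\
  forall T (h : hom B T), comp h i = 0 -> exists! k : hom D T, comp k p = h.

(* The square  i' o f = f' o i  with  f' : B -> B',  i' : A' -> B'. *)
Definition is_pushout (A B A' B' : C) (i : hom A B) (f : hom A A')
    (i' : hom A' B') (f' : hom B B') : Prop :=
  comp i' f = comp f' i /\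
  forall T (u : hom A' T) (v : hom B T), comp u f = comp v i ->
    exists! k : hom B' T, comp k i' = u /\ comp k f' = v.

(* The square  p o f' = f o p'  with  f' : B' -> B,  p' : B' -> D'. *)
Definition is_pullback (B D B' D' : C) (p : hom B D) (f : hom D' D)
    (p' : hom B' D') (f' : hom B' B) : Prop :=
  comp p f' = comp f p' /\
  forall T (u : hom T B) (v : hom T D'), comp p u = comp f v ->
    exists! k : hom T B', comp f' k = u /\ comp p' k = v.

Context (conf : forall A B D : C, hom A B -> hom B D -> Prop).

Definition inflation (A B : C) (i : hom A B) : Prop :=
  exists D (p : hom B D), conf i p.

Definition deflation (B D : C) (p : hom B D) : Prop :=
  exists A (i : hom A B), conf i p.

(* Quillen's axioms, for the class [conf] of distinguished short sequences. *)
Record exact_category : Prop := ExactCategory {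
  ex_additive : additive_category;
  ex_kercoker : forall A B D (i : hom A B) (p : hom B D),
    conf i p -> is_kernel i p /\ is_cokernel i p;
  ex_iso : forall A B D A' B' D' (i : hom A B) (p : hom B D)
      (i' : hom A' B') (p' : hom B' D')
      (a : hom A A') (b : hom B B') (d : hom D D'),
    is_iso a -> is_iso b -> is_iso d ->
    comp b i = comp i' a -> comp d p = comp p' b -> conf i p -> conf i' p';
  ex_idi : forall A, inflation (idm A);
  ex_idd : forall A, deflation (idm A);
  ex_compi : forall A B D (i : hom A B) (j : hom B D),
    inflation i -> inflation j -> inflation (comp j i);
  ex_compd : forall A B D (p : hom A B) (q : hom B D),
    deflation p -> deflation q -> deflation (comp q p);
  ex_pushout : forall A B A' (i : hom A B) (f : hom A A'), inflation i ->
    exists B' (i' : hom A' B') (f' : hom B B'),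
      is_pushout i f i' f' /\ inflation i';
  ex_pullback : forall B D D' (p : hom B D) (f : hom D' D), deflation p ->
    exists B' (p' : hom B' D') (f' : hom B' B),
      is_pullback p f p' f' /\ deflation p' }.

Definition ex_projective (P : C) : Prop :=
  forall B D (p : hom B D) (f : hom P D), deflation p ->
    exists g : hom P B, comp p g = f.

Definition ex_injective (J : C) : Prop :=
  forall A B (i : hom A B) (f : hom A J), inflation i ->
    exists g : hom B J, comp g i = f.

Definition enough_projectives : Prop :=
  forall X : C, exists (P : C) (p : hom P X), ex_projective P /\ deflation p.

Definition enough_injectives : Prop :=
  forall X : C, exists (J : C) (i : hom X J), ex_injective J /\ inflation i.

Definition frobenius_category : Prop :=
  [/\ exact_category, enough_projectives, enough_injectives
    & forall X : C, ex_projective X <-> ex_injective X].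

End Category.

Section FullSubcategory.
Context (C : preadditive) (Q : C -> Prop).

Definition full_subcat : preadditive :=
  @Preadditive {X : C | Q X} (fun X Y => hom (sval X) (sval Y))
    (fun X => idm (sval X)) (fun X Y Z g f => comp g f)
    (fun X Y Z T h g f => compA h g f)
    (fun X Y f => comp1m f) (fun X Y f => compm1 f)
    (fun X Y Z g h f => compDl g h f) (fun X Y Z g f h => compDr g f h).

End FullSubcategory.

Section Circle.
Context (K : realType).
Implicit Types x y a b : K.

Definition circ_rel x y : bool := (x - y) / (2 * pi) \is a Num.int.

Lemma circ_rel_refl : reflexive circ_rel.
Proof. by move=> x; rewrite /circ_rel subrr mul0r rpred0. Qed.

Lemma circ_rel_sym : symmetric circ_rel.
Proof. by move=> x y; rewrite /circ_rel -opprB mulNr rpredN. Qed.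

Lemma circ_rel_trans : transitive circ_rel.
Proof.
rewrite /circ_rel => y x z xy yz.
have -> : x - z = (x - y) + (y - z) by ring.
by rewrite mulrDl; exact: rpredD.
Qed.

Canonical circ_equiv := EquivRel circ_rel circ_rel_refl circ_rel_sym circ_rel_trans.

Definition S1 := {eq_quot circ_equiv}%qT.
HB.instance Definition _ := Choice.on S1.
HB.instance Definition _ := EqQuotient.on S1.

Definition cls x : S1 := \pi_(S1)%qT x.

Lemma clsP x y : reflect (exists m : int, x - y = 2 * pi * m%:~R) (cls x == cls y).
Proof.
have tp : 2 * pi != 0 :> K by rewrite mulf_neq0// gt_eqF// pi_gt0.
have -> : (cls x == cls y) = circ_rel x y by rewrite /cls eqmodE.
rewrite /circ_rel; apply: (iffP (@intrP K _)) => -[m e]; exists m.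
  by rewrite -e mulrC divfK.
by rewrite e [2 * pi * _]mulrC mulfK.
Qed.

(* [rot p a] is p - a, for the action of the real line on the circle. *)
Definition rot (p : S1) a : S1 := cls (repr p - a).

Lemma rot_cls x a : rot (cls x) a = cls (x - a).
Proof.
have /eqP/clsP[m e] : cls (repr (cls x)) = cls x by rewrite /cls reprK.
by apply/eqP/clsP; exists m; rewrite -e; ring.
Qed.

Lemma rotD (p : S1) a b : rot (rot p a) b = rot p (a + b).
Proof. by rewrite [rot p a]/rot rot_cls /rot opprD addrA. Qed.

(* The arrows from p to q: the pairs of a real number a >= 0 with q = p - a. *)
Definition arc (p q : S1) a : bool := (0 <= a) && (q == rot p a).

Lemma arcD p q r a b : arc p q b -> arc q r a -> arc p r (a + b).
Proof.
move=> /andP[b0 /eqP->] /andP[a0 /eqP->].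
by rewrite /arc addr_ge0//= rotD addrC.
Qed.

Lemma arc0 p : arc p p 0.
Proof. by rewrite /arc lexx /rot subr0 /cls reprK /=. Qed.

Lemma arc_loop p n : arc p p (2 * pi * n%:R).
Proof.
rewrite /arc mulr_ge0 ?ler0n ?mulr_ge0 ?pi_ge0//= -[p in p == _]reprK -/(cls _).
by apply/clsP; exists n%:Z; rewrite opprB addrC subrK.
Qed.

Definition arcset x y : set S1 := [set cls u | u in [set u | x <= u <= y]].

(* The a in [0, 2 pi) with q = p - a. *)
Definition ang (p q : S1) : K :=
  let d := repr p - repr q in d - 2 * pi * (Num.floor (d / (2 * pi)))%:~R.

Lemma twopi_gt0 : 0 < 2 * pi :> K.
Proof. by rewrite mulr_gt0// pi_gt0. Qed.

Lemma ang_ge0 p q : 0 <= ang p q.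
Proof.
rewrite /ang; set d := _ - repr q; rewrite subr_ge0 mulrC -ler_pdivlMr ?twopi_gt0//.
exact: ge_floor.
Qed.

Lemma ang_lt p q : ang p q < 2 * pi.
Proof.
rewrite /ang; set d := _ - repr q.
have := floorD1_gt (d / (2 * pi)); rewrite rmorphD rmorph1 ltr_pdivrMr ?twopi_gt0//.
by rewrite mulrDl mul1r [_%:~R * _]mulrC -ltrBlDl.
Qed.

Lemma arc_ang p q : arc p q (ang p q).
Proof.
rewrite /arc ang_ge0 /=; rewrite -[q in q == _]reprK -/(cls _); apply/clsP.
rewrite /ang; set d := _ - repr q; exists (- Num.floor (d / (2 * pi))).
by rewrite rmorphN /= /d; ring.
Qed.

Lemma arc_angE p q a :
  arc p q a -> a = ang p q + 2 * pi * (Num.truncn (a / (2 * pi)))%:R.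
Proof.
have tp : 2 * pi != 0 :> K by rewrite gt_eqF// twopi_gt0.
move=> /andP[a0]; rewrite -[q in q == _]reprK -/(cls _) => /clsP[m e].
have -> : (Num.truncn (a / (2 * pi)))%:R = (Num.floor (a / (2 * pi)))%:~R :> K.
  have h : 0 <= a / (2 * pi) by rewrite divr_ge0// ltW// twopi_gt0.
  by rewrite truncn_floor h natr_absz ger0_norm// floor_ge0.
rewrite /ang.
have -> : repr p - repr q = a - 2 * pi * m%:~R by rewrite -e; ring.
have -> : (a - 2 * pi * m%:~R) / (2 * pi) = a / (2 * pi) + (- m)%:~R.
  by rewrite rmorphN mulrBl [2 * pi * _]mulrC mulfK.
rewrite floorDrz ?intr_int// intrKfloor rmorphD rmorphN /=; ring.
Qed.

End Circle.

Section Dprod.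
Context (R : pzRingType) (I : Type) (V : I -> lmodType R).

Definition depprod : Type := forall i, V i.
HB.instance Definition _ := gen_eqMixin depprod.
HB.instance Definition _ := gen_choiceMixin depprod.

Implicit Types u v w : depprod.

Fact depprod_addA : associative (fun u v : depprod => (fun i => u i + v i) : depprod).
Proof. by move=> u v w; apply: functional_extensionality_dep => i; rewrite addrA. Qed.
Fact depprod_addC : commutative (fun u v : depprod => (fun i => u i + v i) : depprod).
Proof. by move=> u v; apply: functional_extensionality_dep => i; rewrite addrC. Qed.
Fact depprod_add0 : left_id ((fun i => 0) : depprod)
  (fun u v : depprod => (fun i => u i + v i) : depprod).
Proof. by move=> u; apply: functional_extensionality_dep => i; rewrite add0r. Qed.
Fact depprod_addN : left_inverse ((fun i => 0) : depprod)
  (fun u => (fun i => - u i) : depprod)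
  (fun u v : depprod => (fun i => u i + v i) : depprod).
Proof. by move=> u; apply: functional_extensionality_dep => i; rewrite addNr. Qed.
HB.instance Definition _ := GRing.isZmodule.Build depprod
  depprod_addA depprod_addC depprod_add0 depprod_addN.

Fact depprod_scaleA (a b : R) v :
  (fun i => a *: (b *: v i)) = (fun i => (a * b) *: v i) :> depprod.
Proof. by apply: functional_extensionality_dep => i; rewrite scalerA. Qed.
Fact depprod_scale1 : left_id (1 : R) (fun a v => (fun i => a *: v i) : depprod).
Proof. by move=> v; apply: functional_extensionality_dep => i; rewrite scale1r. Qed.
Fact depprod_scaleDr : right_distributive
  (fun (a : R) v => (fun i => a *: v i) : depprod) +%R.
Proof. by move=> a u v; apply: functional_extensionality_dep => i; rewrite scalerDr. Qed.
Fact depprod_scaleDl v :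
  {morph (fun (a : R) => (fun i => a *: v i) : depprod) : a b / a + b}.
Proof. by move=> a b; apply: functional_extensionality_dep => i; rewrite scalerDl. Qed.
HB.instance Definition _ := GRing.Zmodule_isLmodule.Build R depprod
  depprod_scaleA depprod_scale1 depprod_scaleDr depprod_scaleDl.

End Dprod.

Section Rep.
Context (K : realType) (R : idomainType) (t : R).
Local Notation S1 := (S1 K).
Local Notation twopi := (2 * pi : K).

(* A structure map is indexed by its source p, its target q and a real number
   a >= 0 with q = p - a, so that no transport along equalities of points of
   the circle is needed. *)
Record rep := Rep {
  rmod :> S1 -> lmodType R;
  ract : forall (p q : S1) (a : K), arc p q a -> rmod p -> rmod q;
  ract_linear : forall p q a (h : arc p q a), linear (ract h);
  ract_comp : forall p q r a b (hb : arc p q b) (ha : arc q r a)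
    (h : arc p r (a + b)) v, ract ha (ract hb v) = ract h v;
  ract_loop : forall p n (h : arc p p (twopi * n%:R)) v, ract h v = t ^+ n *: v }.

HB.instance Definition _ (V : rep) p q a (h : arc p q a) :=
  GRing.isLinear.Build R (V p) (V q) *:%R (ract h) (ract_linear h).

Lemma ract0 (V : rep) p (h : arc p p 0) (v : V p) : ract h v = v.
Proof.
have h' := h; have e : 0 = twopi * 0%:R by rewrite mulr0.
by move: h; rewrite e => h; rewrite ract_loop expr0 scale1r.
Qed.

Lemma ract_eq (V : rep) p q a b (ha : arc p q a) (hb : arc p q b) (v : V p) :
  a = b -> ract ha v = ract hb v.
Proof. by move=> e; subst b; rewrite (bool_irrelevance ha hb). Qed.

Record mor (V W : rep) := Mor {
  mfun :> forall p, V p -> W p;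
  mfun_linear : forall p, linear (@mfun p);
  mfun_nat : forall p q a (h : arc p q a) v,
    ract h (mfun v) = mfun (ract h v) }.

HB.instance Definition _ (V W : rep) (f : mor V W) p :=
  GRing.isLinear.Build R (V p) (W p) *:%R (@mfun _ _ f p) (@mfun_linear _ _ f p).

Lemma morP (V W : rep) (f g : mor V W) : (forall p v, f p v = g p v) -> f = g.
Proof.
case: f g => [f fl fn] [g gl gn] /= e.
have {}e : f = g.
  by do 2!apply: functional_extensionality_dep => ?; exact: e.
by subst g; congr Mor; exact: Prop_irrelevance.
Qed.

Section MorZmod.
Context (V W : rep).
HB.instance Definition _ := gen_eqMixin (mor V W).
HB.instance Definition _ := gen_choiceMixin (mor V W).

Program Definition mor0 : mor V W := @Mor V W (fun p _ => 0) _ _.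
Next Obligation. by move=> p a u v; rewrite scaler0 addr0. Qed.
Next Obligation. by move=> p q a h v; rewrite linear0. Qed.

Program Definition mor_opp (f : mor V W) : mor V W :=
  @Mor V W (fun p v => - f p v) _ _.
Next Obligation. by move=> f p a u v; rewrite linearP opprD scalerN. Qed.
Next Obligation. by move=> f p q a h v; rewrite linearN /= mfun_nat. Qed.

Program Definition mor_add (f g : mor V W) : mor V W :=
  @Mor V W (fun p v => f p v + g p v) _ _.
Next Obligation. by move=> f g p a u v; rewrite !linearP scalerDr addrACA. Qed.
Next Obligation. by move=> f g p q a h v; rewrite linearD /= !mfun_nat. Qed.

Fact mor_addA : associative mor_add.
Proof. by move=> f g h; apply: morP => p v; exact: addrA. Qed.
Fact mor_addC : commutative mor_add.
Proof. by move=> f g; apply: morP => p v; exact: addrC. Qed.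
Fact mor_add0 : left_id mor0 mor_add.
Proof. by move=> f; apply: morP => p v; exact: add0r. Qed.
Fact mor_addN : left_inverse mor0 mor_opp mor_add.
Proof. by move=> f; apply: morP => p v; exact: addNr. Qed.
HB.instance Definition _ :=
  GRing.isZmodule.Build (mor V W) mor_addA mor_addC mor_add0 mor_addN.
End MorZmod.

Program Definition mor_id (V : rep) : mor V V := @Mor V V (fun p v => v) _ _.
Next Obligation. by []. Qed.
Next Obligation. by []. Qed.

Program Definition mor_comp (U V W : rep) (g : mor V W) (f : mor U V) : mor U W :=
  @Mor U W (fun p v => g p (f p v)) _ _.
Next Obligation. by move=> U V W g f p a u v; rewrite !linearP. Qed.
Next Obligation. by move=> U V W g f p q a h v; rewrite !mfun_nat. Qed.

Lemma mor_compE (U V W : rep) (g : mor V W) (f : mor U V) p v :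
  mor_comp g f p v = g p (f p v).
Proof. by []. Qed.

Definition epi (V W : rep) (f : mor V W) : Prop :=
  forall p (w : W p), exists v : V p, f p v = w.

Definition short_exact (U V W : rep) (f : mor U V) (g : mor V W) : Prop :=
  [/\ (forall p, injective (@mfun _ _ f p)),
      (forall p (v : V p), g p v = 0 <-> exists u : U p, f p u = v) & epi g].

Definition projective (V : rep) : Prop :=
  forall (X Y : rep) (g : mor X Y) (f : mor V Y), epi g ->
    exists h : mor V X, mor_comp g h = f.

Program Definition dsum n (V : 'I_n -> rep) : rep :=
  @Rep (fun p => depprod (fun i => V i p))
    (fun p q a h v => (fun i => ract h (v i))) _ _ _.
Next Obligation.
by move=> n V p q a h b u v; apply: functional_extensionality_dep => i; exact: linearP.
Qed.
Next Obligation.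
by move=> n V p q r a b hb ha h v; apply: functional_extensionality_dep => i; exact: ract_comp.
Qed.
Next Obligation.
by move=> n V p k h v; apply: functional_extensionality_dep => i; exact: ract_loop.
Qed.

Program Definition dsum_proj n (V : 'I_n -> rep) j : mor (dsum V) (V j) :=
  @Mor (dsum V) (V j) (fun p v => v j) _ _.
Next Obligation. by []. Qed.
Next Obligation. by []. Qed.

Definition dinj n (V : 'I_n -> rep) i p (u : V i p) : depprod (fun k => V k p) :=
  fun k => if i =P k is ReflectT e then ecast l (V l p) e u else 0.

Program Definition dsum_inj n (V : 'I_n -> rep) i : mor (V i) (dsum V) :=
  @Mor (V i) (dsum V) (fun p u => dinj u) _ _.
Next Obligation.
move=> n V i p a u v; apply: functional_extensionality_dep => k.
rewrite /GRing.add /GRing.scale /= /dinj; case: eqP => [e|_].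
  by case: k / e.
by rewrite scaler0 addr0.
Qed.
Next Obligation.
move=> n V i p q a h v; apply: functional_extensionality_dep => k /=.
rewrite /dinj; case: eqP => [e|_]; first by case: k / e.
by rewrite linear0.
Qed.

Program Definition rsum (V W : rep) : rep :=
  @Rep (fun p => (V p * W p)%type)
    (fun p q a h v => (ract h v.1, ract h v.2)) _ _ _.
Next Obligation. by move=> V W p q a h b u v; rewrite !linearP. Qed.
Next Obligation. by move=> V W p q r a b hb ha h v /=; congr (_, _); exact: ract_comp. Qed.
Next Obligation. by move=> V W p n h [v w]; rewrite !ract_loop. Qed.

(* Prep p q below is free of rank one on the generator e_p^a, a = ang p q. An
   arc of length b from q to q' sends it to e_p^(b + a) = t^n e_p^(ang p q'),
   where b + a = ang p q' + 2 pi n and n = wind p q b. *)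
Definition wind (p q : S1) (b : K) : nat := Num.truncn ((b + ang p q) / twopi).

Lemma windE p q q' b : arc q q' b ->
  b + ang p q = ang p q' + twopi * (wind p q b)%:R.
Proof. by move=> h; apply: arc_angE; exact: arcD (arc_ang p q) h. Qed.

Lemma windD p q q' b c : arc q q' b -> 0 <= c ->
  wind p q (c + b) = (wind p q' c + wind p q b)%N.
Proof.
move=> h c0; have tp := twopi_gt0 K; rewrite {1}/wind -addrA (windE p h).
have -> : (c + (ang p q' + twopi * (wind p q b)%:R)) / twopi =
    (wind p q b)%:R + (c + ang p q') / twopi.
  rewrite addrA addrC mulrDl; congr (_ + _).
  by rewrite [twopi * _]mulrC mulfK// gt_eqF.
rewrite truncnD ?rpred_nat//; first by rewrite natrK addnC.
by rewrite nnegrE; apply: divr_ge0 (ltW tp); rewrite addr_ge0 ?ang_ge0.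
Qed.

Program Definition Prep (p : S1) : rep :=
  @Rep (fun _ => R^o) (fun q q' b _ r => t ^+ wind p q b * r) _ _ _.
Next Obligation. by move=> p q q' b _ a u v /=; rewrite mulrDr mulrCA. Qed.
Next Obligation.
move=> p q q' q'' a b hb ha h v /=.
by case/andP: ha => a0 _; rewrite (windD p hb a0) exprD mulrA.
Qed.
Next Obligation.
move=> p q n h v /=; congr (t ^+ _ * v).
have := windE p h; rewrite addrC => /addrI/mulfI; rewrite gt_eqF ?twopi_gt0// => /(_ isT)/eqP.
by rewrite eqr_nat => /eqP.
Qed.

(* The element e_p^a of Prep p q, for any a >= 0 with q = p - a. *)
Definition gen p q a (h : arc p q a) : Prep p q := t ^+ Num.truncn (a / twopi).

Lemma ract_gen p q q' a b (ha : arc p q a) (hb : arc q q' b)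
    (h : arc p q' (b + a)) :
  ract hb (gen ha) = gen h.
Proof.
have tp := twopi_gt0 K; rewrite /gen /= -exprD; congr (t ^+ _).
have -> : (b + a) / twopi =
    (Num.truncn (a / twopi))%:R + (b + ang p q) / twopi.
  rewrite {1}(arc_angE ha) addrA addrC mulrDl; congr (_ + _).
  by rewrite [twopi * _]mulrC mulfK// gt_eqF.
rewrite truncnD ?rpred_nat//.
  by rewrite natrK addnC.
by case/andP: hb => b0 _; rewrite nnegrE; apply: divr_ge0 (ltW tp); rewrite addr_ge0 ?ang_ge0.
Qed.

Lemma gen_ang p q : gen (arc_ang p q) = 1.
Proof.
rewrite /gen; suff -> : Num.truncn (ang p q / twopi) = 0%N by [].
by apply: truncn_def; rewrite divr_ge0 ?ang_ge0 ?ltW ?twopi_gt0//=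
  ltr_pdivrMr ?twopi_gt0// mul1r ang_lt.
Qed.

Lemma P_gen p q (r : Prep p q) : r = r *: ract (arc_ang p q) (gen (arc0 p)).
Proof.
have h : arc p q (ang p q + 0) by rewrite addr0 arc_ang.
rewrite (ract_gen _ _ h); have -> : gen h = 1; last by rewrite [RHS]mulr1.
by rewrite -(gen_ang p q) /gen addr0.
Qed.

(* The morphism sending e_p to v. *)
Program Definition from_gen p (W : rep) (v : W p) : mor (Prep p) W :=
  @Mor (Prep p) W (fun q r => r *: ract (arc_ang p q) v) _ _.
Next Obligation. by move=> p W v q a r s; rewrite scalerDl scalerA. Qed.
Next Obligation.
move=> p W v q q' b h r /=; rewrite linearZ /=.
have h1 : arc p q' (b + ang p q) := arcD (arc_ang p q) h.
rewrite (ract_comp _ _ h1) -scalerA [RHS]scalerA [_ * r]mulrC -scalerA.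
congr (_ *: _).
have h2 := arc_loop q' (wind p q b).
rewrite -(ract_loop h2); have h3 := arcD (arc_ang p q') h2.
by rewrite (ract_comp _ _ h3); apply: ract_eq; rewrite (windE p h) addrC.
Qed.

Lemma from_genE p q a (h : arc p q a) (W : rep) (v : W p) :
  from_gen v q (gen h) = ract h v.
Proof.
rewrite /= /gen; have h2 := arc_loop q (Num.truncn (a / twopi)).
rewrite -(ract_loop h2); have h3 := arcD (arc_ang p q) h2.
by rewrite (ract_comp _ _ h3); apply: ract_eq; rewrite addrC -(arc_angE h).
Qed.

Lemma P_mor_eq p (W : rep) (f g : mor (Prep p) W) :
  f p (gen (arc0 p)) = g p (gen (arc0 p)) -> f = g.
Proof.
move=> e; apply: morP => q r.
have A (k : mor (Prep p) W) : k q r = r *: ract (arc_ang p q) (k p (gen (arc0 p))).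
  by rewrite mfun_nat {1}[r]P_gen; exact: linearZ.
by rewrite !A e.
Qed.

Lemma P_projective p : projective (Prep p).
Proof.
move=> X Y g f sg; have [v gv] := sg p (f p (gen (arc0 p))).
exists (from_gen v); apply: P_mor_eq.
by rewrite mor_compE from_genE ract0 gv.
Qed.

Definition finitely_generated (V : rep) : Prop :=
  exists n (x : 'I_n -> S1) (f : mor (dsum (fun i => Prep (x i))) V), epi f.

(* [has_depth f a]: f is nonzero of depth a; the zero morphism, of depth
   infinity, has no real depth. *)
Definition has_depth p q (f : mor (Prep p) (Prep q)) (a : K) : Prop :=
  exists (h : arc q p a) (u : R),
    u \is a GRing.unit /\ f p (gen (arc0 p)) = u *: gen h.

Definition mor_iso (V W : rep) (f : mor V W) : Prop :=
  exists g : mor W V, mor_comp g f = mor_id V /\ mor_comp f g = mor_id W.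

(* a and b are decompositions of the source and of the target of f. The bound
   y0 < x0 + 2 pi makes the interval a proper subset of the circle. *)
Definition depth_interval (V W : rep) (f : mor V W)
    m (x : 'I_m -> S1) (a : mor (dsum (fun i => Prep (x i))) V)
    n (y : 'I_n -> S1) (b : mor W (dsum (fun j => Prep (y j)))) (I : set S1) : Prop :=
  exists i j (x0 y0 : K),
    [/\ cls x0 = x i, cls y0 = y j, x0 <= y0 < x0 + twopi,
        has_depth (mor_comp (dsum_proj (fun j => Prep (y j)) j)
          (mor_comp b (mor_comp f (mor_comp a (dsum_inj (fun i => Prep (x i)) i)))))
          (y0 - x0)
      & I = arcset x0 y0].

(* Since these intervals do not depend on the decompositions, it is enough that
   some pair of decompositions exhibits I. *)
Definition support_interval (V W : rep) (f : mor V W) (I : set S1) : Prop :=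
  exists m (x : 'I_m -> S1) (a : mor (dsum (fun i => Prep (x i))) V)
         n (y : 'I_n -> S1) (b : mor W (dsum (fun j => Prep (y j)))),
    [/\ mor_iso a, mor_iso b, depth_interval f a b I
      & forall J, depth_interval f a b J -> J `<=` I -> J = I].

Record fpi := Fpi {
  frep :> rep;
  frep_fg : finitely_generated frep;
  frep_proj : projective frep;
  fd : mor frep frep;
  fd_sqr : forall p v, fd p (fd p v) = t *: v }.

Record fpi_mor (X Y : fpi) := FpiMor {
  fmor :> mor X Y;
  fmor_d : mor_comp fmor (fd X) = mor_comp (fd Y) fmor }.

Lemma fpi_morP (X Y : fpi) (f g : fpi_mor X Y) : fmor f = fmor g -> f = g.
Proof.
case: f g => [f fc] [g gc] /= e; subst g; congr FpiMor; exact: Prop_irrelevance.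
Qed.

Section FpiZmod.
Context (X Y : fpi).
HB.instance Definition _ := gen_eqMixin (fpi_mor X Y).
HB.instance Definition _ := gen_choiceMixin (fpi_mor X Y).

Program Definition fpi_mor0 : fpi_mor X Y := @FpiMor X Y 0 _.
Next Obligation. by apply: morP => p v /=; rewrite linear0. Qed.
Program Definition fpi_opp (f : fpi_mor X Y) : fpi_mor X Y :=
  @FpiMor X Y (- fmor f) _.
Next Obligation.
move=> f; apply: morP => p v /=; have /(congr1 (fun g => mfun g v)) /= e := fmor_d f.
by rewrite linearN e.
Qed.
Program Definition fpi_add (f g : fpi_mor X Y) : fpi_mor X Y :=
  @FpiMor X Y (fmor f + fmor g) _.
Next Obligation.
move=> f g; apply: morP => p v /=.
have /(congr1 (fun g => mfun g v)) /= e := fmor_d f.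
have /(congr1 (fun g => mfun g v)) /= e' := fmor_d g.
by rewrite linearD e e'.
Qed.

Fact fpi_addA : associative fpi_add.
Proof. by move=> f g h; apply: fpi_morP; exact: addrA. Qed.
Fact fpi_addC : commutative fpi_add.
Proof. by move=> f g; apply: fpi_morP; exact: addrC. Qed.
Fact fpi_add0 : left_id fpi_mor0 fpi_add.
Proof. by move=> f; apply: fpi_morP; exact: add0r. Qed.
Fact fpi_addN : left_inverse fpi_mor0 fpi_opp fpi_add.
Proof. by move=> f; apply: fpi_morP; exact: addNr. Qed.
HB.instance Definition _ :=
  GRing.isZmodule.Build (fpi_mor X Y) fpi_addA fpi_addC fpi_add0 fpi_addN.
End FpiZmod.

Program Definition fpi_id (X : fpi) : fpi_mor X X := @FpiMor X X (mor_id X) _.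
Next Obligation. by move=> X; exact: morP. Qed.

Program Definition fpi_comp (X Y Z : fpi) (g : fpi_mor Y Z) (f : fpi_mor X Y) :
  fpi_mor X Z := @FpiMor X Z (mor_comp (fmor g) (fmor f)) _.
Next Obligation.
move=> X Y Z g f; apply: morP => p v /=.
have /(congr1 (fun g => mfun g v)) /= -> := fmor_d f.
by have /(congr1 (fun h => mfun h (f p v))) /= -> := fmor_d g.
Qed.

Program Definition Fpi_cat : preadditive :=
  @Preadditive fpi (fun X Y => fpi_mor X Y) fpi_id fpi_comp _ _ _ _ _.
Next Obligation. by move=> *; apply: fpi_morP; exact: morP. Qed.
Next Obligation. by move=> *; apply: fpi_morP; exact: morP. Qed.
Next Obligation. by move=> *; apply: fpi_morP; exact: morP. Qed.
Next Obligation. by move=> *; apply: fpi_morP; exact: morP. Qed.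
Next Obligation.
by move=> *; apply: fpi_morP; apply: morP => p v; exact: linearD.
Qed.

Program Definition mor_pair (U V W : rep) (f : mor U V) (g : mor U W) :
  mor U (rsum V W) := @Mor U (rsum V W) (fun p v => (f p v, g p v)) _ _.
Next Obligation. by move=> U V W f g p a u v; rewrite !linearP. Qed.
Next Obligation. by move=> U V W f g p q a h v /=; rewrite !mfun_nat. Qed.

Program Definition mor_fst (V W : rep) : mor (rsum V W) V :=
  @Mor (rsum V W) V (fun p v => v.1) _ _.
Next Obligation. by []. Qed.
Next Obligation. by []. Qed.

Program Definition mor_snd (V W : rep) : mor (rsum V W) W :=
  @Mor (rsum V W) W (fun p v => v.2) _ _.
Next Obligation. by []. Qed.
Next Obligation. by []. Qed.

Lemma rsum_projective (V W : rep) :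
  projective V -> projective W -> projective (rsum V W).
Proof.
move=> pV pW X Y g f sg.
have z (A B : rep) : mor A B by exact: 0.
have [h1 e1] := pV X Y g (mor_comp f (mor_pair (mor_id V) 0)) sg.
have [h2 e2] := pW X Y g (mor_comp f (mor_pair 0 (mor_id W))) sg.
exists (mor_comp h1 (mor_fst V W) + mor_comp h2 (mor_snd V W)).
apply: morP => p [v w] /=.
have /(congr1 (fun h => mfun h v)) /= e1' := e1.
have /(congr1 (fun h => mfun h w)) /= e2' := e2.
by rewrite linearD /= e1' e2' -linearD /=; congr (f p (_, _)); rewrite ?addr0 ?add0r.
Qed.

Lemma rsum_fg p q : finitely_generated (rsum (Prep p) (Prep q)).
Proof.
pose x (i : 'I_2) := if val i == 0%N then p else q.
exists 2%N, x, (mor_pair (dsum_proj (fun i => Prep (x i)) ord0)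
  (dsum_proj (fun i => Prep (x i)) ord_max)) => s -[v w].
by exists (fun i => if val i == 0%N then v else w).
Qed.

(* The morphism Prep p -> Prep q sending e_p to e_q^a, where p = q - a. *)
Definition star p q a (h : arc q p a) : mor (Prep p) (Prep q) := from_gen (gen h).

Lemma star_star p q a b (hp : arc q p a) (hq : arc p q b) s (v : Prep p s) :
  a + b = twopi -> star hq s (star hp s v) = t *: v.
Proof.
move=> e; suff eS : mor_comp (star hq) (star hp) = from_gen (t *: gen (arc0 p)).
  rewrite -mor_compE eS {2}[v]P_gen scalerA mulrC -scalerA.
  by congr (v *: _); exact: linearZ.
apply: P_mor_eq; rewrite mor_compE /star [RHS]from_genE !ract0.
rewrite [X in from_gen _ _ X]from_genE ract0 from_genE.
have h : arc p p (a + b) by exact: arcD hq hp.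
rewrite (ract_gen _ _ h) /gen mul0r truncn0 e.
by rewrite divff ?gt_eqF ?twopi_gt0// truncn1 expr0 expr1 [RHS]mulr1.
Qed.

Section Eobj.
Context (x y : K) (h : x <= y <= x + twopi).

Fact E_alpha : arc (cls y) (cls x) (y - x).
Proof.
by case/andP: h => h1 _; rewrite /arc subr_ge0 h1 rot_cls subKr eqxx.
Qed.

Fact E_beta : arc (cls x) (cls y) (x + twopi - y).
Proof.
case/andP: h => _ h2; rewrite /arc subr_ge0 h2 rot_cls /=; apply/clsP.
by exists 1; ring.
Qed.

Program Definition Eobj : fpi :=
  @Fpi (rsum (Prep (cls x)) (Prep (cls y))) (rsum_fg _ _)
    (rsum_projective (@P_projective _) (@P_projective _))
    (mor_pair (mor_comp (star E_beta) (mor_snd _ _))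
              (mor_comp (star E_alpha) (mor_fst _ _))) _.
Next Obligation.
move=> p [v w]; congr (_, _); apply: star_star; ring.
Qed.

End Eobj.

Context (phi : K -> K).

Definition in_Fphi (X : fpi) : Prop :=
  forall I, support_interval (fd X) I -> exists z, arcset z (phi z) `<=` I.

Definition Fphi_cat : preadditive := @full_subcat Fpi_cat in_Fphi.

Definition Fphi_exact (X Y Z : Fphi_cat) (f : hom X Y) (g : hom Y Z) : Prop :=
  short_exact (fmor f) (fmor g).

End Rep.

(* Main.v *)
From HB Require Import structures.
From mathcomp Require Import all_boot all_order all_algebra.
From mathcomp Require Import boolp classical_sets reals topology trigo.
From mathcomp Require Import realfun.
From mathcomp Require Import ring lra.
Require Import Defs.

Set Implicit Arguments.
Unset Strict Implicit.
Unset Printing Implicit Defensive.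

Import Order.TTheory GRing.Theory Num.Theory.
Import numFieldTopology.Exports.
Local Open Scope ring_scope.

(** The proof rests on an intrinsic form of the condition on support intervals.
   Let d be the endomorphism of an object X. A unit coefficient of d between two
   summands P_[x] and P_[y] of X is a depth interval [x, y], which contains some
   [z, phi z] exactly when phi x <= y, that is, when the image of the generator
   e_x comes from X[phi x]; a coefficient that is not a unit is divisible by t,
   and its image comes from X[phi x] anyway because phi x - x <= 2 pi. So X is
   in F_phi if and only if, for every real x, the map d : X[x] -> X[x] has its
   values in the image of the structure map X[phi x] -> X[x]
   ([d_liftable_in_Fphi], [in_Fphi_d_liftable]). The passage from minimal
   intervals to all depth intervals uses that there are finitely many of them,
   and the existence of one decomposition to look at uses that R is local
   ([retract_basis]).

   This condition passes to sums and to direct summands as representations.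
   All objects are projective representations, so deflations are the pointwise
   surjections, and inflations are the morphisms with a retraction that need not
   commute with d. Kernels and cokernels are images of idempotents, on which d
   induces the required endomorphism, and Quillen's axioms follow; a pushout is
   the cokernel of (i, -f) and a pullback the kernel of (p, -f).

   The object E(x, phi x) represents the functor X |-> X[x]: a vector v of X[x]
   is the image of the first generator, and the second generator then goes to the
   unique w in X[phi x] above d v. It is therefore projective. Dually, a morphism
   from X to E(x, phi x) is the same thing as a morphism of representations from
   X to P_[phi x], so E(x, phi x) is injective. As X is finitely generated, it is
   covered by a finite sum of such objects; as it is a summand of a finite sum of
   representations P_[phi x], it embeds into one ([Ephi_cover], [Ephi_cocover]).
   Hence the projectives and the injectives are both the summands of finite sums
   of objects E(x, phi x).

   Finally the endomorphism ring of E(x, phi x) is R[d] with d^2 = t, which is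
   local. By the exchange argument [retract_exchange] every indecomposable summand
   of a finite sum of these objects is one of them. When x + 2 pi = phi y, the
   object E(x, y) is E(y, phi y) with its two summands exchanged. *)

(** * Retracts and local objects in a preadditive category *)

Section Retracts.
Context (C : preadditive).
Implicit Types X Y Z S E F : C.

Lemma comp0m X Y Z (f : hom X Y) : comp (0 : hom Y Z) f = 0.
Proof. by apply: (addrI (comp 0 f)); rewrite -compDl !addr0. Qed.

Lemma compm0 X Y Z (g : hom Y Z) : comp g (0 : hom X Y) = 0.
Proof. by apply: (addrI (comp g 0)); rewrite -compDr !addr0. Qed.

Lemma compNm X Y Z (g : hom Y Z) (f : hom X Y) : comp (- g) f = - comp g f.
Proof. by apply/eqP; rewrite -addr_eq0 -compDl addNr comp0m. Qed.

Lemma compmN X Y Z (g : hom Y Z) (f : hom X Y) : comp g (- f) = - comp g f.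
Proof. by apply/eqP; rewrite -addr_eq0 -compDr addNr compm0. Qed.

Lemma compBm X Y Z (g h : hom Y Z) (f : hom X Y) : comp (g - h) f = comp g f - comp h f.
Proof. by rewrite compDl compNm. Qed.

Lemma compmB X Y Z (g : hom Y Z) (f h : hom X Y) : comp g (f - h) = comp g f - comp g h.
Proof. by rewrite compDr compmN. Qed.

Lemma is_zero_hom0 X Y (f : hom X Y) : is_zero Y -> f = 0.
Proof. by move=> z; rewrite -[f]comp1m z comp0m. Qed.

Definition retract X Y := exists (i : hom X Y) (p : hom Y X), comp p i = idm X.

Lemma isomorphic_sym X Y : isomorphic X Y -> isomorphic Y X.
Proof. by move=> [f [g [gf fg]]]; exists g, f. Qed.

Lemma isomorphic_trans X Y Z : isomorphic X Y -> isomorphic Y Z -> isomorphic X Z.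
Proof.
move=> [f [g [gf fg]]] [f' [g' [gf' fg']]]; exists (comp f' f), (comp g g').
by rewrite -!compA (compA g') gf' comp1m (compA f) fg comp1m.
Qed.

Lemma isomorphic_retract X Y : isomorphic X Y -> retract X Y.
Proof. by move=> [f [g [gf _]]]; exists f, g. Qed.

Lemma is_zero_retract X Y : retract X Y -> is_zero Y -> is_zero X.
Proof. by move=> [i [p pi]] z; rewrite /is_zero -pi (is_zero_hom0 i z) compm0. Qed.

Lemma biproduct_zerol S E F : is_biproduct S E F -> is_zero E -> isomorphic S F.
Proof.
move=> [i1 [i2 [p1 [p2 [e1 e2 _ _ es]]]]] z; exists p2, i2; split=> //.
by rewrite -es (is_zero_hom0 p1 z) compm0 add0r.
Qed.

Lemma biproduct_sym S E F : is_biproduct S E F -> is_biproduct S F E.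
Proof.
move=> [i1 [i2 [p1 [p2 [e1 e2 e3 e4 es]]]]].
by exists i2, i1, p2, p1; split=> //; rewrite addrC.
Qed.

Lemma isomorphic_biproduct S S' E F :
  isomorphic S S' -> is_biproduct S E F -> is_biproduct S' E F.
Proof.
move=> [f [g [gf fg]]] [i1 [i2 [p1 [p2 [e1 e2 e3 e4 es]]]]].
have K X (h : hom S X) Y (k : hom Y S) : comp (comp h g) (comp f k) = comp h k.
  by rewrite -compA (compA g) gf comp1m.
exists (comp f i1), (comp f i2), (comp p1 g), (comp p2 g); split; rewrite ?K//.
by rewrite -!compA -compDr !compA -compDl es comp1m.
Qed.

Lemma isomorphic_indecomposable X Y :
  isomorphic X Y -> indecomposable X -> indecomposable Y.
Proof.
move=> XY [nz dec]; split; first by move=> /(is_zero_retract (isomorphic_retract XY)).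
by move=> A B /(isomorphic_biproduct (isomorphic_sym XY)); exact: dec.
Qed.

(** The kernel of a split epimorphism r is a complement: 1 - i r factors through
   it, and that factor is the second projection. *)
Lemma kernel_retract_biproduct X E Y (i : hom E X) (r : hom X E) (k : hom Y X) :
  comp r i = idm E -> is_kernel k r -> is_biproduct X E Y.
Proof.
move=> ri [rk kP].
have mono Z (a b : hom Z Y) : comp k a = comp k b -> a = b.
  move=> e; have [|c [_ cP]] := kP Z (comp k a); first by rewrite compA rk comp0m.
  by rewrite -(cP a)// -(cP b)// e.
have [|q [kq _]] := kP X (idm X - comp i r).
  by rewrite compmB compm1 compA ri comp1m subrr.
exists i, k, r, q; split=> //; last by rewrite kq addrC subrK.
- by apply: mono; rewrite compA kq compBm comp1m compm1 -compA rk compm0 subr0.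
- by apply: mono; rewrite compA kq compBm comp1m -compA ri compm1 subrr compm0.
Qed.

(** The endomorphism ring of X is local. *)
Definition local_obj X :=
  ~ is_zero X /\ forall c : hom X X, is_iso c \/ is_iso (idm X - c).

(** An invertible idempotent is the identity, so the idempotent i1 p1 of a
   decomposition is 1 or 0. *)
Lemma local_indecomposable X : local_obj X -> indecomposable X.
Proof.
move=> [nz loc]; split=> // A B [i1 [i2 [p1 [p2 [e1 e2 e3 e4 es]]]]].
have idem : comp (comp i1 p1) (comp i1 p1) = comp i1 p1.
  by rewrite -compA (compA p1) e1 comp1m.
have {es} es : idm X - comp i1 p1 = comp i2 p2 by rewrite -es addrC addKr.
have idem2 : comp (comp i2 p2) (comp i2 p2) = comp i2 p2.
  by rewrite -compA (compA p2) e2 comp1m.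
have idem1 c : is_iso c -> comp c c = c -> c = idm X.
  by move=> [g [gc cg]] cc; rewrite -[LHS]comp1m -gc -compA cc.
have [/idem1/(_ idem) c1|] := loc (comp i1 p1).
  right; rewrite /is_zero -e2 -[i2](comp1m) -{1}c1 -!compA (compA p2) e4.
  by rewrite comp0m.
rewrite es => /idem1/(_ idem2) c1; left.
by rewrite /is_zero -e1 -[i1]comp1m -{1}c1 -!compA (compA p1) e3 comp0m.
Qed.

(** Azumaya's exchange argument, in the form p1 i1 + p2 i2 = 1 on X: either
   i1 p1 is invertible, or 1 - i1 p1 is, and then so is 1 - p1 i1 = p2 i2, with
   inverse 1 + p1 (1 - i1 p1)^-1 i1. *)
Lemma retract_exchange X S E F :
  is_biproduct S E F -> retract X S -> local_obj E -> retract E X \/ retract X F.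
Proof.
move=> [j1 [j2 [q1 [q2 [e1 e2 e3 e4 es]]]]] [i [p pi]] [_ loc].
set i1 := comp q1 i; set p1 := comp p j1.
set i2 := comp q2 i; set p2 := comp p j2.
have sum1 : comp p1 i1 + comp p2 i2 = idm X.
  by rewrite -!compA (compA j1) (compA j2) -compDr -compDl es comp1m pi.
have [[g [gc _]]|[u [uc cu]]] := loc (comp i1 p1).
  by left; exists p1, (comp g i1); rewrite -compA.
right; exists i2, (comp (idm X + comp (comp p1 u) i1) p2).
have e : comp p2 i2 = idm X - comp p1 i1 by rewrite -sum1 addrC addKr.
rewrite -compA e compDl comp1m -addrA -[RHS]addr0; congr (_ + _).
have -> : comp (comp (comp p1 u) i1) (idm X - comp p1 i1) =
    comp (comp p1 (comp u (idm E - comp i1 p1))) i1.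
  by rewrite !compmB !compm1 compBm -!compA.
by rewrite uc compm1 addNr.
Qed.

Inductive sum_of (G : C -> Prop) : C -> Prop :=
| Sum0 S : is_zero S -> sum_of G S
| SumS S E F : G E -> sum_of G F -> is_biproduct S E F -> sum_of G S.

Lemma retract_sum_of (G : C -> Prop) X S : (forall E, G E -> local_obj E) ->
  sum_of G S -> retract X S -> ~ is_zero X -> exists E, G E /\ retract E X.
Proof.
move=> loc GS; elim: GS X => [S' z X XS nz|S' E F GE _ IH bi X XS nz].
  by case: nz; exact: is_zero_retract z.
have [EX|XF] := retract_exchange bi XS (loc E GE); first by exists E.
exact: IH XF nz.
Qed.

Section Conflations.
Context (conf : forall A B D : C, hom A B -> hom B D -> Prop).

Lemma retract_projective X Y : retract X Y -> ex_projective conf Y -> ex_projective conf X.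
Proof.
move=> [i [p pi]] pY B D q f dq; have [g gE] := pY B D q (comp f p) dq.
by exists (comp g i); rewrite compA gE -compA pi compm1.
Qed.

Lemma retract_injective X Y : retract X Y -> ex_injective conf Y -> ex_injective conf X.
Proof.
move=> [i [p pi]] iY A B j f ij; have [g gE] := iY A B j (comp i f) ij.
by exists (comp p g); rewrite -compA gE compA pi comp1m.
Qed.

Lemma deflation_projective_retract X P (p : hom P X) :
  ex_projective conf X -> deflation conf p -> retract X P.
Proof. by move=> pX dp; have [g gE] := pX _ _ p (idm X) dp; exists g, p. Qed.

Lemma inflation_injective_retract X J (i : hom X J) :
  ex_injective conf X -> inflation conf i -> retract X J.
Proof. by move=> iX ii; have [g gE] := iX _ _ i (idm X) ii; exists i, g. Qed.

Lemma sum_of_projective (G : C -> Prop) S : (forall E, G E -> ex_projective conf E) ->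
  sum_of G S -> ex_projective conf S.
Proof.
move=> prG; elim=> [Z z B D p f _|Z E F GE _ IH [i1 [i2 [p1 [p2 [e1 e2 e3 e4 es]]]]]].
  by exists 0; rewrite -[f]compm1 z !compm0.
move=> B D p f dp; have [g1 e1'] := prG E GE B D p (comp f i1) dp.
have [g2 e2'] := IH B D p (comp f i2) dp.
exists (comp g1 p1 + comp g2 p2).
by rewrite compDr !compA e1' e2' -!compA -compDr es compm1.
Qed.

Lemma sum_of_injective (G : C -> Prop) S : (forall E, G E -> ex_injective conf E) ->
  sum_of G S -> ex_injective conf S.
Proof.
move=> inG; elim=> [Z z A B i f _|Z E F GE _ IH [i1 [i2 [p1 [p2 [e1 e2 e3 e4 es]]]]]].
  by exists 0; rewrite -[f]comp1m z !comp0m.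
move=> A B i f ii; have [g1 e1'] := inG E GE A B i (comp p1 f) ii.
have [g2 e2'] := IH A B i (comp p2 f) ii.
exists (comp i1 g1 + comp i2 g2).
by rewrite compDl -!compA e1' e2' !compA -compDl es comp1m.
Qed.

End Conflations.
End Retracts.

(** * Discrete valuation rings *)

Section DVR.
Context (R : idomainType) (t : R) (R_dvr : is_dvr R) (t_unif : is_uniformizer t).
Local Open Scope classical_set_scope.

Lemma ideal_principal (a : R) : is_ideal (principal_ideal a).
Proof.
split=> [|_ _ [r _ <-] [s _ <-]|r _ [s _ <-]]; first by exists 0; rewrite ?mul0r.
  by exists (r + s); rewrite ?mulrDl.
by exists (r * s); rewrite ?mulrA.
Qed.

Lemma uniformizer_nunit : t \isn't a GRing.unit.
Proof.
apply/negP => tU; case: t_unif => _ t1 _; apply: t1.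
by exists t^-1; rewrite // mulVr.
Qed.

Lemma uniformizer_neq0 : t != 0.
Proof.
case: R_dvr => _ _ [a [a0 aU]]; apply/eqP => t0.
have [_ _ maxt] := t_unif.
have a1 : ~ principal_ideal a 1.
  by move=> [r _ e]; case/negP: aU; apply/unitrP; exists r; rewrite [a * r]mulrC e.
have ta : principal_ideal t `<=` principal_ideal a.
  by move=> x [r _ <-]; rewrite t0 mulr0; exists 0; rewrite // mul0r.
have /maxt/(_ a1 ta) := ideal_principal a.
move=> /(_ a)[|r _ /esym/eqP]; first by exists 1; rewrite ?mul1r.
by rewrite t0 mulr0 (negbTE a0).
Qed.

(** Krull's theorem. The empty set is allowed in the Zorn argument so that the
   empty chain has an upper bound; a maximal element is nonempty because the
   ideal generated by a is. *)
Lemma nunit_maximal_ideal (a : R) : a \isn't a GRing.unit ->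
  exists I, is_maximal_ideal I /\ I a.
Proof.
move=> aU; pose P (I : set R) := I !=set0 -> [/\ is_ideal I, I a & ~ I 1].
have [F FP totF|I [PI maxI]] := @Zorn_bigcup R P.
  move=> [x [I FI Ix]]; have [[I0 _ _] Ia _] := FP I FI (ex_intro _ x Ix).
  have FP' J y : F J -> J y -> [/\ is_ideal J, J a & ~ J 1].
    by move=> FJ Jy; apply: FP => //; exists y.
  split; last 2 first.
  - by exists I.
  - by move=> [J FJ J1]; have [_ _] := FP' J _ FJ J1; exact.
  split; first by exists I.
    move=> y z [J FJ Jy] [L FL Lz].
    have [[_ JD _] _ _] := FP' J y FJ Jy; have [[_ LD _] _ _] := FP' L z FL Lz.
    have [JL|LJ] := totF J L FJ FL; first by exists L => //; apply: LD => //; exact: JL.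
    by exists J => //; apply: JD => //; exact: LJ.
  by move=> r y [J FJ Jy]; have [[_ _ JM] _ _] := FP' J y FJ Jy; exists J => //; exact: JM.
have Pa : P (principal_ideal a).
  move=> _; split; [exact: ideal_principal|by exists 1; rewrite ?mul1r|].
  by move=> [r _ e]; case/negP: aU; apply/unitrP; exists r; rewrite [a * r]mulrC e.
have I0 : I !=set0.
  apply: contrapT => /nonemptyPn I0; apply: (maxI (principal_ideal a)) => //.
  rewrite I0; split; first by [].
  by move=> /(_ a); apply; exists 1; rewrite ?mul1r.
have [idI Ia I1] := PI I0; exists I; split=> //; split=> // J idJ J1 IJ.
apply: contrapT => JI; apply: (maxI J); first by split.
by move=> _; split=> //; exact: IJ.
Qed.

Lemma nunit_dvd (a : R) : a \isn't a GRing.unit -> exists c, a = t * c.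
Proof.
case: R_dvr => _ [M [_ uM]] _ /nunit_maximal_ideal[I [/uM-> ]].
rewrite -(uM _ t_unif) => -[c _ <-]; by exists c; rewrite mulrC.
Qed.

Lemma unit_or_unit1B (a : R) : a \is a GRing.unit \/ 1 - a \is a GRing.unit.
Proof.
have [|/nunit_dvd[c ec]] := boolP (a \is a GRing.unit); [by left|right].
apply/negPn/negP => /nunit_dvd[b eb]; have := uniformizer_nunit.
move=> /negP; apply; apply/unitrP; exists (b + c).
have : t * (b + c) = 1 by rewrite mulrDr -eb -ec subrK.
by rewrite mulrC => ->.
Qed.

End DVR.

(** * Periodic homeomorphisms of the line *)

Section PeriodicHomeo.
Context (K : realType) (phi : K -> K) (phi_homeo : homeomorphism phi)
  (phi_period : forall x : K, phi (x + 2 * pi) = phi x + 2 * pi).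

Lemma phi_cancel : exists psi : K -> K, cancel phi psi /\ cancel psi phi.
Proof. by case: phi_homeo => _ [psi [_ a b]]; exists psi. Qed.

(** A continuous injection is strictly monotone, and the translation property
   excludes the decreasing case. *)
Lemma phi_mono : {mono phi : x y / x <= y}.
Proof.
case: phi_homeo => phi_c [psi [_ can _]].
have : unstable.strict_monotonic (`]-oo, +oo[ : interval K) phi.
  apply: itv_continuous_inj_mono; last exact: in2W (can_inj can).
  by apply: continuous_in_subspaceT => y _; exact: phi_c.
case=> mono.
  by apply: le_mono => x y; apply: mono; rewrite in_itv.
have p0 := twopi_gt0 K.
have := mono (2 * pi) 0; rewrite !in_itv => /(_ isT isT p0).
by rewrite -[2 * pi]add0r phi_period ltNge lerDl ltW.
Qed.

Lemma phi_periodz (m : int) x : phi (x + 2 * pi * m%:~R) = phi x + 2 * pi * m%:~R.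
Proof.
have N n y : phi (y + 2 * pi * n%:R) = phi y + 2 * pi * n%:R.
  elim: n y => [|n IH] y; first by rewrite !mulr0 !addr0.
  by rewrite -[n.+1%:R]natr1 mulrDr mulr1 !addrA phi_period IH.
case: m => n; first exact: N.
rewrite NegzE rmorphN mulrN; have := N n.+1 (x - 2 * pi * n.+1%:R).
by rewrite subrK => ->; rewrite addrK.
Qed.

End PeriodicHomeo.

(** * Morphisms of representations *)

Section Representations.
Context (K : realType) (R : idomainType) (t : R).
Local Notation S1 := (S1 K).
Local Notation rep := (rep K t).
Local Notation Prep := (Prep t).
Implicit Types (U V W X Y : rep) (p q : S1).

Lemma mor_eq V W (f g : mor V W) : f = g -> forall p v, f p v = g p v.
Proof. by move=> ->. Qed.

Lemma mor_addE V W (f g : mor V W) p v : (f + g) p v = f p v + g p v.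
Proof. by []. Qed.

Lemma mor_sumE V W n (f : 'I_n -> mor V W) p v :
  (\sum_i f i) p v = \sum_i f i p v.
Proof. by rewrite (big_morph (fun g : mor V W => g p v) (id1 := 0) (op1 := +%R)). Qed.

(** The pointwise factorization through an injective morphism is unique, and
   uniqueness makes it linear and compatible with the structure maps. *)
Lemma mor_factor X A B (m : mor A B) (f : mor X B) :
  (forall p, injective (@mfun _ _ _ _ _ m p)) ->
  (forall p v, exists u, m p u = f p v) -> exists k : mor X A, mor_comp m k = f.
Proof.
move=> inj ex.
pose k p v := sval (cid (ex p v)).
have kE p v : m p (k p v) = f p v by exact: svalP (cid (ex p v)).
have k_lin p : linear (k p).
  by move=> a u v; apply: inj; rewrite linearP /= !kE linearP.
have k_nat p q a (h : arc p q a) v : ract h (k p v) = k q (ract h v).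
  by apply: inj; rewrite -mfun_nat !kE mfun_nat.
by exists (Mor k_lin k_nat); apply: morP => p v; exact: kE.
Qed.

Lemma mor_bij_iso V W (f : mor V W) :
  (forall p, injective (@mfun _ _ _ _ _ f p)) -> epi f -> mor_iso f.
Proof.
move=> inj sur; have [g fg] := mor_factor (f := mor_id W) inj sur.
exists g; split=> //; apply: morP => p v; apply: inj.
exact: (mor_eq fg).
Qed.

Definition rep_retract X Y := exists (i : mor X Y) (r : mor Y X), mor_comp r i = mor_id X.

Lemma rep_retract_projective X Y : rep_retract X Y -> projective Y -> projective X.
Proof.
move=> [i [r ri]] pY A B g f eg; have [h gh] := pY A B g (mor_comp f r) eg.
exists (mor_comp h i); apply: morP => p v.
by have /= := mor_eq gh (i p v); have /= -> := mor_eq ri v.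
Qed.

Lemma rep_retract_fg X Y : rep_retract X Y -> finitely_generated Y -> finitely_generated X.
Proof.
move=> [i [r ri]] [n [x [f ef]]]; exists n, x, (mor_comp r f) => p v.
have [u e] := ef p (i p v); exists u.
by rewrite mor_compE e; exact: (mor_eq ri).
Qed.

(** * Images of idempotents *)

Section ImageOfIdempotent.
Context (V : rep) (e : mor V V).

Definition fixed_by p : {pred V p} := fun v => `[< e p v = v >].

Fact fixed_by_submod p : submod_closed (@fixed_by p).
Proof.
split=> [|a u v]; rewrite !unfold_in; first by apply/asboolP; rewrite linear0.
by move=> /asboolP eu /asboolP ev; apply/asboolP; rewrite linearP /= eu ev.
Qed.
HB.instance Definition _ p :=
  GRing.isSubmodClosed.Build R (V p) (@fixed_by p) (@fixed_by_submod p).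

Record fixed p := Fixed { fixed_val :> V p; fixed_valP : fixed_val \in @fixed_by p }.
HB.instance Definition _ p := [isSub for @fixed_val p].
HB.instance Definition _ p := [Choice of fixed p by <:].
HB.instance Definition _ p := [SubChoice_isSubLmodule of fixed p by <:].

Fact fixed_ract p q a (h : arc p q a) (v : fixed p) : ract h (val v) \in @fixed_by q.
Proof.
rewrite unfold_in; apply/asboolP.
by have := fixed_valP v; rewrite unfold_in -mfun_nat => /asboolP->.
Qed.

Program Definition im_rep : rep :=
  @Rep K R t (fun p => fixed p : lmodType R)
    (fun p q a h v => Fixed (fixed_ract h v)) _ _ _.
Next Obligation. by move=> p q a h b u v; apply: val_inj; exact: linearP. Qed.
Next Obligation. by move=> p q r a b hb ha h v; apply: val_inj; exact: ract_comp. Qed.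
Next Obligation. by move=> p n h v; apply: val_inj; exact: ract_loop. Qed.

Program Definition im_incl : mor im_rep V := @Mor K R t im_rep V (fun p v => val v) _ _.
Next Obligation. by []. Qed.
Next Obligation. by []. Qed.

Context (ee : mor_comp e e = e).

Fact im_proj_in p v : e p v \in @fixed_by p.
Proof. by rewrite unfold_in; apply/asboolP; exact: (mor_eq ee). Qed.

Program Definition im_proj : mor V im_rep :=
  @Mor K R t V im_rep (fun p v => Fixed (im_proj_in v)) _ _.
Next Obligation. by move=> p a u v; apply: val_inj; exact: linearP. Qed.
Next Obligation. by move=> p q a h v; apply: val_inj; exact: mfun_nat. Qed.

End ImageOfIdempotent.

Lemma split_idempotent V (e : mor V V) : mor_comp e e = e ->
  exists W (i : mor W V) (r : mor V W), mor_comp r i = mor_id W /\ mor_comp i r = e.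
Proof.
move=> ee; exists (im_rep e), (im_incl e), (im_proj ee); split; last exact: morP.
apply: morP => p v; apply: val_inj => /=.
by have := fixed_valP v; rewrite unfold_in => /asboolP.
Qed.

(** * Finite direct sums of the representations P *)

Lemma depprod_sumE (I : Type) (F : I -> lmodType R) n (u : 'I_n -> depprod F) k :
  (\sum_i u i) k = \sum_i u i k.
Proof.
by rewrite (big_morph (fun w : depprod F => w k) (id1 := 0) (op1 := +%R)).
Qed.

Lemma dinj_same n (V : 'I_n -> rep) i p (u : V i p) : dinj u i = u.
Proof. by rewrite /dinj; case: eqP => // e; rewrite (eq_irrelevance e erefl). Qed.

Lemma dinj_neq n (V : 'I_n -> rep) i k p (u : V i p) : i != k -> dinj u k = 0.
Proof. by rewrite /dinj; case: eqP. Qed.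

Lemma dsum_decomp n (V : 'I_n -> rep) p (u : dsum V p) :
  u = \sum_i (dinj (u i) : dsum V p).
Proof.
apply: functional_extensionality_dep => k; rewrite depprod_sumE (bigD1 k)//=.
by rewrite dinj_same big1 ?addr0// => i; exact: dinj_neq.
Qed.

Definition dsum_copair n (V : 'I_n -> rep) W (f : forall i, mor (V i) W) :
  mor (dsum V) W := \sum_i mor_comp (f i) (dsum_proj V i).

Lemma dsum_copairE n (V : 'I_n -> rep) W (f : forall i, mor (V i) W) p (u : dsum V p) :
  dsum_copair f p u = \sum_i f i p (u i).
Proof. by rewrite mor_sumE. Qed.

Lemma dsum_morE n (V : 'I_n -> rep) W (f : mor (dsum V) W) p u :
  f p u = \sum_i mor_comp f (dsum_inj V i) p (u i).
Proof. by rewrite {1}[u]dsum_decomp linear_sum. Qed.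

Program Definition dsum_tuple X n (V : 'I_n -> rep) (f : forall i, mor X (V i)) :
  mor X (dsum V) := @Mor K R t X (dsum V) (fun p v i => f i p v) _ _.
Next Obligation.
by move=> X n V f p a u v; apply: functional_extensionality_dep => i; exact: linearP.
Qed.
Next Obligation.
by move=> X n V f p q a h v; apply: functional_extensionality_dep => i; exact: mfun_nat.
Qed.

Lemma gen0E p : gen t (arc0 p) = 1.
Proof. by rewrite /gen mul0r truncn0 expr0. Qed.

Lemma from_gen_gen p W (v : W p) : from_gen v p (gen t (arc0 p)) = v.
Proof. by rewrite from_genE ract0. Qed.

Lemma from_gen_ang p W (v : W p) q (r : Prep p q) :
  from_gen v q r = r *: ract (arc_ang p q) v.
Proof. by []. Qed.

Lemma P_morE p W (f : mor (Prep p) W) : f = from_gen (f p (gen t (arc0 p))).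
Proof. by apply: P_mor_eq; rewrite from_gen_gen. Qed.

Program Definition mor_scale V (r : R) : mor V V := @Mor K R t V V (fun p v => r *: v) _ _.
Next Obligation. by move=> V r p a u v; rewrite scalerDr !scalerA mulrC. Qed.
Next Obligation. by move=> V r p q a h v; rewrite linearZ. Qed.

Lemma P_endE p (c : mor (Prep p) (Prep p)) : exists r : R, c = mor_scale (Prep p) r.
Proof.
exists (c p (gen t (arc0 p))); apply: P_mor_eq; rewrite /= gen0E.
by rewrite [RHS]mulr1.
Qed.

Lemma fg_projective_retract X : finitely_generated X -> projective X ->
  exists n (x : 'I_n -> S1), rep_retract X (dsum (fun i => Prep (x i))).
Proof.
move=> [n [x [f ef]]] pX; exists n, x.
by have [g fg] := pX _ _ f (mor_id X) ef; exists g, f.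
Qed.

(** * Torsion-freeness *)

Section TorsionFree.
Context (t0 : t != 0).

Definition torsion_free V := forall p (v : V p), t *: v = 0 -> v = 0.

Lemma fg_projective_torsion_free X :
  finitely_generated X -> projective X -> torsion_free X.
Proof.
move=> fX /(fg_projective_retract fX)[n [x [i [r ri]]]] p v tv.
have /= <- := mor_eq ri v; suff -> : i p v = 0 by rewrite linear0.
have {tv} : t *: i p v = 0 by rewrite -linearZ tv linear0.
move=> tv; apply: functional_extensionality_dep => k.
have /= /eqP := congr1 (fun w : depprod _ => w k) tv.
by rewrite mulf_eq0 (negbTE t0) => /eqP.
Qed.

(** An arc of any length is the beginning of an arc that goes round the circle n
   times, which acts as t^n. *)
Lemma ract_inj V p q a (h : arc p q a) : torsion_free V -> injective (@ract _ _ _ V _ _ _ h).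
Proof.
move=> tf u v /eqP; rewrite -subr_eq0 -linearB /= => /eqP uv.
apply/eqP; rewrite -subr_eq0; apply/eqP; set w := u - v in uv *.
have tfn n : t ^+ n *: w = 0 -> w = 0.
  elim: n => [|n IH]; first by rewrite scale1r.
  by rewrite exprS -scalerA => /tf.
pose n := (Num.truncn (a / (2 * pi))).+1.
have a2 : a <= 2 * pi * n%:R.
  rewrite mulrC -ler_pdivrMr ?twopi_gt0//; apply: ltW; rewrite /n.
  by apply: truncnS_gt.
apply: (tfn n); rewrite -(ract_loop (arc_loop p n)).
have h' : arc q p (2 * pi * n%:R - a).
  have /andP[_ /eqP qE] := arc_loop p n; case/andP: (h) => _ /eqP->.
  by rewrite /arc subr_ge0 a2 rotD addrC subrK -qE eqxx.
have h'' : arc p p (2 * pi * n%:R - a + a) by exact: arcD h h'.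
rewrite (ract_eq (arc_loop p n) h''); last by rewrite subrK.
by rewrite -(ract_comp h h' h'') uv linear0.
Qed.

End TorsionFree.

(** * Decomposition of finitely generated projective representations *)

(** The generators carry their points along, so that a family can be extended by
   one generator without any transport between types. *)
Definition is_basis X n (b : 'I_n -> {p : S1 & X p}) :=
  forall q (u : X q), exists! c : 'I_n -> R,
    u = \sum_i c i *: ract (arc_ang (tag (b i)) q) (tagged (b i)).

Lemma basis_decomposition X n (b : 'I_n -> {p : S1 & X p}) : is_basis b ->
  exists a : mor (dsum (fun i => Prep (tag (b i)))) X, mor_iso a.
Proof.
move=> bP; exists (dsum_copair (fun i => from_gen (tagged (b i)))).
apply: mor_bij_iso => [q u v|q u].
  rewrite !dsum_copairE => e.
  have [c [_ cP]] := bP q (\sum_i from_gen (tagged (b i)) q (u i)).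
  by rewrite -(cP u)// -(cP v).
by have [c [-> _]] := bP q u; exists c; rewrite dsum_copairE.
Qed.

(** Induction on the number of summands, X being the sum of p1 i1 and p2 i2,
   through the first summand and through the others. The endomorphism i1 p1 of the
   first summand is a scalar c. If 1 - c is a unit then p2 i2 is invertible, and X
   is a summand of the other summands; if c is a unit then p1 is the inclusion of
   a direct summand of X, whose complement is a summand of the others. *)
Lemma retract_basis (R_loc : forall r : R, r \is a GRing.unit \/ 1 - r \is a GRing.unit)
    n (x : 'I_n -> S1) X :
  rep_retract X (dsum (fun i => Prep (x i))) ->
  exists m (b : 'I_m -> {p : S1 & X p}), is_basis b.
Proof.
elim: n x X => [|n IH] x X [i [r ri]].
  have b (k : 'I_0) : {p : S1 & X p} by case: k.
  exists 0%N, b => q u; exists (fun=> 0); split.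
    rewrite big_ord0 -[u]/(mor_id X q u) -ri /=.
    suff -> : i q u = 0 by rewrite linear0.
    by apply: functional_extensionality_dep => -[].
  by move=> c _; apply: functional_extensionality_dep => -[].
pose F k := Prep (x (lift ord0 k)).
pose i1 := mor_comp (dsum_proj (fun i => Prep (x i)) ord0) i.
pose p1 := mor_comp r (dsum_inj (fun i => Prep (x i)) ord0).
pose i2 : mor X (dsum F) :=
  dsum_tuple (fun k => mor_comp (dsum_proj (fun i => Prep (x i)) (lift ord0 k)) i).
pose p2 : mor (dsum F) X :=
  dsum_copair (fun k => mor_comp r (dsum_inj (fun i => Prep (x i)) (lift ord0 k))).
have sum1 q u : p1 q (i1 q u) + p2 q (i2 q u) = u.
  rewrite dsum_copairE -[RHS]/(mor_id X q u) -ri mor_compE [RHS]dsum_morE.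
  by rewrite big_ord_recl.
clearbody i1 p1 i2 p2.
have [c cE] := P_endE (mor_comp i1 p1).
have i1p1 q u : i1 q (p1 q u) = c *: u by exact: (mor_eq cE u).
have [cU|cU] := R_loc c; last first.
  (* The inverse of 1 - p1 i1 is 1 + p1 (1 - c)^-1 i1. *)
  apply: (IH (fun k => x (lift ord0 k))); exists i2.
  exists (p2 + mor_comp (mor_comp p1 (mor_scale _ (1 - c)^-1)) (mor_comp i1 p2)).
  apply: morP => q u; rewrite mor_compE mor_addE /=.
  have -> : p2 q (i2 q u) = u - p1 q (i1 q u) by rewrite -{2}[u]sum1 addrC addKr.
  rewrite linearB /= i1p1 -{2}[i1 q u]scale1r -scalerBl scalerA mulVr//.
  by rewrite scale1r subrK.
(* The projection onto the kernel of i1 along the image of p1. *)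
pose e : mor X X := mor_id X - mor_comp p1 (mor_comp (mor_scale _ c^-1) i1).
have eE q u : e q u = u - p1 q (c^-1 *: i1 q u) by [].
have i1e q u : i1 q (e q u) = 0.
  by rewrite eE [i1 q _]linearB /= i1p1 scalerA divrr// scale1r subrr.
have ee : mor_comp e e = e.
  by apply: morP => q u /=; rewrite [LHS]eE i1e scaler0 linear0 subr0.
have [Y [j [s [sj js]]]] := split_idempotent ee.
have i1j q y : i1 q (j q y) = 0.
  have /= <- := mor_eq sj y; have /= <- := mor_eq sj (s q (j q y)).
  by have /= -> := mor_eq js (j q (s q (j q y))); exact: i1e.
have [|m [b bP]] := IH (fun k => x (lift ord0 k)) Y.
  exists (mor_comp i2 j), (mor_comp s p2); apply: morP => q y /=.
  have := sum1 q (j q y); rewrite i1j linear0 add0r => ->.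
  exact: (mor_eq sj y).
pose b' (k : 'I_m.+1) : {p : S1 & X p} :=
  if unlift ord0 k is Some l then Tagged (fun p => X p) (j _ (tagged (b l)))
  else Tagged (fun p => X p) (p1 _ (gen t (arc0 (x ord0)))).
have sum_b' q (d : 'I_m.+1 -> R) :
    \sum_k d k *: ract (arc_ang (tag (b' k)) q) (tagged (b' k)) =
    p1 q (d ord0) + j q (\sum_l d (lift ord0 l) *:
      ract (arc_ang (tag (b l)) q) (tagged (b l))).
  rewrite big_ord_recl linear_sum /=; congr (_ + _).
    rewrite /b' unlift_none /= mfun_nat -linearZ; congr (p1 q _).
    by rewrite -P_gen.
  apply: eq_bigr => l _; rewrite /b' liftK /= mfun_nat linearZ.
  by [].
exists m.+1, b' => q u.
have [d [dE dP]] := bP q (s q u).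
have uE : u = p1 q (c^-1 *: i1 q u) + j q (s q u).
  by rewrite -mor_compE js eE addrC subrK.
exists (fun k => if unlift ord0 k is Some l then d l else c^-1 *: i1 q u).
split.
  rewrite sum_b' unlift_none {1}uE; congr (_ + j q _).
  by rewrite {1}dE; apply: eq_bigr => l _; rewrite liftK.
move=> d'; rewrite sum_b' => uE'.
have d'0 : d' ord0 = c^-1 *: i1 q u.
  by rewrite uE' linearD /= i1j addr0 i1p1 scalerA mulVr// scale1r.
apply: functional_extensionality_dep => k; case: unliftP => [l ->|->] //.
suff <- : (fun l => d' (lift ord0 l)) = d by [].
apply/esym/dP; have := uE'; rewrite {1}uE d'0 => /addrI/(congr1 (s q)).
have /= -> := mor_eq sj (s q u); move=> ->.
exact: (mor_eq sj _).
Qed.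

Lemma fg_projective_decomposition
    (R_loc : forall r : R, r \is a GRing.unit \/ 1 - r \is a GRing.unit) X :
  finitely_generated X -> projective X ->
  exists n (x : 'I_n -> S1) (a : mor (dsum (fun i => Prep (x i))) X), mor_iso a.
Proof.
move=> fX /(fg_projective_retract fX)[n [x /(retract_basis R_loc)[m [b bP]]]].
have [a ia] := basis_decomposition bP.
by exists m, (fun i => tag (b i)), a.
Qed.

End Representations.

(** * Arcs of the circle *)

Section Circle.
Context (K : realType).
Implicit Types (x y z w a : K) (p q : S1 K).
Local Open Scope classical_set_scope.

Lemma cls_shift x (m : int) : cls (x + 2 * pi * m%:~R) = cls x.
Proof. by apply/eqP/clsP; exists m; rewrite addrC addKr. Qed.

Lemma clsE x y : cls x = cls y -> exists m : int, x = y + 2 * pi * m%:~R.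
Proof. by move=> /eqP/clsP[m e]; exists m; rewrite -e addrC subrK. Qed.

Lemma cls_repr p : cls (repr p) = p.
Proof. by rewrite /cls reprK. Qed.

Lemma arc_cls p x a : arc p (cls x) a -> cls (x + a) = p.
Proof.
by case/andP=> _ /eqP/clsE[m ->]; rewrite addrAC subrK cls_shift cls_repr.
Qed.

Lemma cls_arc x y : x <= y -> arc (cls y) (cls x) (y - x).
Proof. by move=> xy; rewrite /arc subr_ge0 xy rot_cls subKr eqxx. Qed.

Lemma arc_lt_ang p q a : arc p q a -> a < 2 * pi -> a = ang p q.
Proof.
move=> h a2; rewrite {1}(arc_angE h) (_ : Num.truncn _ = 0%N) ?mulr0 ?addr0//.
apply: truncn_def; case/andP: h => a0 _.
by rewrite divr_ge0 ?(ltW (twopi_gt0 K))//= ltr_pdivrMr ?twopi_gt0// mul1r.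
Qed.

Lemma arcset_shift x y (m : int) :
  arcset x y `<=` arcset (x + 2 * pi * m%:~R) (y + 2 * pi * m%:~R).
Proof.
move=> _ [u /= /andP[xu uy] <-]; exists (u + 2 * pi * m%:~R); last exact: cls_shift.
by rewrite /= !lerD2r xu.
Qed.

(** An arc shorter than the whole circle lifts to disjoint intervals of the
   real line, and a connected subset of their union lies in one of them. *)
Lemma arcset_sub x y z w : z <= w -> y < x + 2 * pi ->
  arcset z w `<=` arcset x y ->
  exists m : int, x <= z + 2 * pi * m%:~R /\ w + 2 * pi * m%:~R <= y.
Proof.
move=> zw yx sub; have p0 := twopi_gt0 K.
have [|u /= /andP[xu uy] /clsE[m uE]] := sub (cls z); first by exists z; rewrite //= lexx.
exists m; rewrite -uE; split=> //; rewrite leNgt; apply/negP => yw.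
(* A point just after y, still before w and before the next copy of [x, y]. *)
pose v := Num.min (w + 2 * pi * m%:~R) ((y + (x + 2 * pi)) / 2).
have yv : y < v by rewrite lt_min yw /=; lra.
have vx : v < x + 2 * pi by rewrite gt_min; apply/orP; right; lra.
have vw : v <= w + 2 * pi * m%:~R by rewrite ge_min lexx.
have [|u' /= /andP[xu' u'y] /clsE[n u'E]] := sub (cls (v - 2 * pi * m%:~R)).
  exists (v - 2 * pi * m%:~R); rewrite //= lerBrDr lerBlDr vw andbT -uE.
  exact: le_trans uy (ltW yv).
have {u'E} u'E : u' = v + 2 * pi * (n - m)%:~R.
  by rewrite u'E rmorphB mulrBr addrAC addrA.
have n0 : n - m < 0.
  rewrite ltNge; apply/negP => n0.
  have : 0 <= 2 * pi * (n - m)%:~R :> K by rewrite mulr_ge0 ?ler0z// ltW.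
  lra.
have n1 : n - m <= -1 by rewrite -ltzD1 addNr.
have : 2 * pi * (n - m)%:~R <= 2 * pi * (-1)%:~R :> K.
  by rewrite ler_pM2l// ler_int.
rewrite rmorphN mulrN1; lra.
Qed.

End Circle.

(** * Support intervals and the lifting condition *)

Section DepthIntervals.
Context (K : realType) (R : idomainType) (t : R).
Local Notation rep := (rep K t).
Local Notation Prep := (Prep t).
Local Open Scope classical_set_scope.

Lemma gen_lt (p q : S1 K) a (h : arc p q a) : a < 2 * pi -> gen t h = 1.
Proof.
move=> /(arc_lt_ang h) aE; rewrite -(gen_ang t p q) /gen.
by rewrite aE.
Qed.

(** The length of a depth interval is determined by the two summands, so among
   the finitely many depth intervals inside I one of least length exists. *)
Lemma minimal_depth_interval (V W : rep) (f : mor V W)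
    m (x : 'I_m -> S1 K) (a : mor (dsum (fun i => Prep (x i))) V)
    n (y : 'I_n -> S1 K) (b : mor W (dsum (fun j => Prep (y j)))) I :
  depth_interval f a b I ->
  exists J, [/\ depth_interval f a b J, J `<=` I
    & forall J', depth_interval f a b J' -> J' `<=` J -> J' = J].
Proof.
move=> [i [j [x0 [y0 [xi yj xy dep IE]]]]].
pose P (k : 'I_m * 'I_n) := `[< exists (x0 y0 : K),
  [/\ cls x0 = x k.1, cls y0 = y k.2, x0 <= y0 < x0 + 2 * pi,
    has_depth (mor_comp (dsum_proj (fun j => Prep (y j)) k.2)
      (mor_comp b (mor_comp f (mor_comp a (dsum_inj (fun i => Prep (x i)) k.1)))))
      (y0 - x0)
  & arcset x0 y0 `<=` I] >].
have P0 : P (i, j) by apply/asboolP; exists x0, y0; split=> //; rewrite IE.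
case: (@arg_minP _ _ _ (i, j) P (fun k => ang (y k.2) (x k.1)) P0) => k.
move=> /asboolP[x1 [y1 [xk yk xy1 dep1 sub1]]] kmin.
have len (k' : 'I_m * 'I_n) x2 y2 (g : mor (Prep (x k'.1)) (Prep (y k'.2))) :
    x2 <= y2 < x2 + 2 * pi -> has_depth g (y2 - x2) -> y2 - x2 = ang (y k'.2) (x k'.1).
  by move=> /andP[_ lt2] [h _]; apply: arc_lt_ang h _; rewrite ltrBlDr addrC.
exists (arcset x1 y1); split=> //; first by exists k.1, k.2, x1, y1.
move=> _ [i2 [j2 [x2 [y2 [xi2 yj2 xy2 dep2 ->]]]]] sub.
have P2 : P (i2, j2).
  by apply/asboolP; exists x2, y2; split=> //; exact: subset_trans sub1.
have := kmin _ P2; rewrite -(len _ _ _ _ xy1 dep1) -(len (i2, j2) _ _ _ xy2 dep2).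
case/andP: xy1 => _ lt1; case/andP: (xy2) => le2 _.
have [l [xl yl]] := arcset_sub le2 lt1 sub.
move=> short; apply/seteqP; split=> //.
have -> : x1 = x2 + 2 * pi * l%:~R by lra.
have -> : y1 = y2 + 2 * pi * l%:~R by lra.
have := @arcset_shift K (x2 + 2 * pi * l%:~R) (y2 + 2 * pi * l%:~R) (- l).
by rewrite rmorphN mulrN !addrK.
Qed.

End DepthIntervals.

Section Lifts.
Context (K : realType) (R : idomainType) (t : R) (phi : K -> K).
Local Notation rep := (rep K t).
Local Notation Prep := (Prep t).
Context (phi_homeo : homeomorphism phi)
  (phi_period : forall x : K, phi (x + 2 * pi) = phi x + 2 * pi)
  (phi_bound : forall x : K, x <= phi x < x + pi).
Context (R_dvr : is_dvr R) (t_unif : is_uniformizer t).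
Local Open Scope classical_set_scope.

Lemma phi_arc x : arc (cls (phi x)) (cls x) (phi x - x).
Proof. by apply: cls_arc; case/andP: (phi_bound x). Qed.

Lemma phi_step_le x : phi x - x <= 2 * pi.
Proof. by have /andP[] := phi_bound x; have := pi_gt0 K; lra. Qed.

Definition liftable (V : rep) x (v : V (cls x)) :=
  exists w : V (cls (phi x)), ract (phi_arc x) w = v.

Lemma liftable0 (V : rep) x : liftable (0 : V (cls x)).
Proof. by exists 0; rewrite linear0. Qed.

Lemma liftableD (V : rep) x (u v : V (cls x)) :
  liftable u -> liftable v -> liftable (u + v).
Proof. by move=> [w <-] [w' <-]; exists (w + w'); rewrite linearD. Qed.

Lemma liftableZ (V : rep) x (r : R) (v : V (cls x)) : liftable v -> liftable (r *: v).
Proof. by move=> [w <-]; exists (r *: w); rewrite linearZ. Qed.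

Lemma liftable_sum (V : rep) x n (v : 'I_n -> V (cls x)) :
  (forall i, liftable (v i)) -> liftable (\sum_i v i).
Proof.
by move=> h; elim/big_ind: _ => [|u w|i _]; [exact: liftable0|exact: liftableD|].
Qed.

Lemma liftable_mor (V W : rep) (f : mor V W) x (v : V (cls x)) :
  liftable v -> liftable (f _ v).
Proof. by move=> [w <-]; exists (f _ w); rewrite mfun_nat. Qed.

(** Moving from x back to y <= x moves phi x back to phi y, because phi is
   increasing. *)
Lemma liftable_ract (V : rep) x y a (h : arc (cls x) (cls y) a) (v : V (cls x)) :
  liftable v -> liftable (ract h v).
Proof.
move=> [w <-]; case/andP: (h) => a0; rewrite rot_cls => /eqP/clsE[m yE].
have phi_yE : phi y = phi (x - a) + 2 * pi * m%:~R by rewrite yE phi_periodz.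
have hw : arc (cls (phi x)) (cls (phi y)) (phi x - phi (x - a)).
  rewrite phi_yE cls_shift; apply: cls_arc.
  by rewrite (phi_mono phi_homeo phi_period) gerBl.
exists (ract hw w).
rewrite (ract_comp hw (phi_arc y) (arcD hw (phi_arc y))).
rewrite (ract_comp (phi_arc x) h (arcD (phi_arc x) h)).
by apply: ract_eq; rewrite phi_yE yE; ring.
Qed.

(** The arc from phi x to x multiplies by a power of t whose exponent, the number
   of times it passes the point q, is at most 1; the exponent is 0 when the arc
   is not longer than the distance from q to x. *)
Lemma P_liftable q x (c : Prep q (cls x)) :
  (exists d, c = t * d) \/ phi x - x <= ang q (cls x) -> liftable c.
Proof.
have p0 := twopi_gt0 K; have lt2 := ang_lt q (cls (phi x)); have ge0 := ang_ge0 q (cls x).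
move=> H; have wE := windE q (phi_arc x); have s2 := phi_step_le x.
suff [e ce] : exists e : R, c = t ^+ wind q (cls (phi x)) (phi x - x) * e by exists e.
case: H => [[d ->]|small].
  case wE1: (wind q (cls (phi x)) (phi x - x)) wE => [|[|n]] wE.
  - by exists (t * d); rewrite expr0 mul1r.
  - by exists d; rewrite expr1.
  - have : 2 * pi * 2 <= 2 * pi * n.+2%:R :> K by rewrite ler_pM2l// ler_nat.
    lra.
case wE1: (wind q (cls (phi x)) (phi x - x)) wE => [|n] wE.
  by exists c; rewrite expr0 mul1r.
have : 2 * pi * 1 <= 2 * pi * n.+1%:R :> K by rewrite ler_pM2l// ler1n.
lra.
Qed.

(** The intrinsic form of the condition on support intervals. *)
Definition d_liftable (X : fpi K t) := forall x (v : X (cls x)), liftable (fd X (cls x) v).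

(** The coefficient of d on a support interval [x0, y0] is a unit, so its lift to
   phi x0 is not multiplied by t on the way to x0: the arc from phi x0 to x0 does
   not pass the point y0. *)
Lemma d_liftable_in_Fphi X : d_liftable X -> in_Fphi phi X.
Proof.
move=> lX I [m [x [a [n [y [b [_ _ dI _]]]]]]].
case: dI => i [j [x0 [y0 [xi yj /andP[xy yx] [h [u [uU uE]]] ->]]]].
have lt2 : y0 - x0 < 2 * pi by rewrite ltrBlDr addrC.
pose f := mor_comp (dsum_proj (fun j => Prep (y j)) j) b.
suff H p (xp : cls x0 = p) (h' : arc (y j) p (y0 - x0)) (v : X p) :
    f p (fd X p v) = u *: gen t h' -> phi x0 <= y0.
  exists x0 => _ [v /= /andP[xv vy] <-]; exists v => //=; rewrite xv /=.
  by apply: le_trans vy _; exact: H xi h _ uE.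
subst p; have [w <-] := lX x0 v; rewrite -mfun_nat (gen_lt t h' lt2) [RHS]mulr1 => e.
have {}e : t ^+ wind (y j) (cls (phi x0)) (phi x0 - x0) * f _ w = u := e.
have := windE (y j) (phi_arc x0); rewrite -(arc_lt_ang h' lt2).
have := ang_ge0 (y j) (cls (phi x0)); case: wind e => [_|k e]; first lra.
by move: uU; rewrite -e exprS -mulrA unitrM (negbTE (uniformizer_nunit t_unif)).
Qed.

(** In a decomposition of X, a coefficient of d is divisible by t or gives a depth
   interval. The latter contains a support interval, hence some [z, phi z], and
   is thus long enough for the coefficient to lift. *)
Lemma in_Fphi_d_liftable X : in_Fphi phi X -> d_liftable X.
Proof.
move=> FX; have R_loc := unit_or_unit1B R_dvr t_unif.
have [n [x [a ia]]] := fg_projective_decomposition R_loc (@frep_fg _ _ _ X) (@frep_proj _ _ _ X).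
have [y xE] : exists y : 'I_n -> K, x = fun i => cls (y i).
  by exists (fun i => repr (x i)); apply/funext => i; rewrite cls_repr.
subst x; have [b [ba ab]] := ia; have ib : mor_iso b by exists a.
pose inj i := dsum_inj (fun i => Prep (cls (y i))) i.
pose v i := a (cls (y i)) (inj i (cls (y i)) (gen t (arc0 (cls (y i))))).
pose c i j : R := b (cls (y i)) (fd X _ (v i)) j.
have c_small i j : (exists e, c i j = t * e) \/
    phi (y i) - y i <= ang (cls (y j)) (cls (y i)).
  have [cU|] := boolP (c i j \is a GRing.unit); [right|by move=> /(nunit_dvd R_dvr t_unif); left].
  set x0 := y i; pose y0 := x0 + ang (cls (y j)) (cls (y i)).
  have y0x0 : y0 - x0 = ang (cls (y j)) (cls (y i)) by rewrite addrC addKr.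
  have dI : depth_interval (fd X) a b (arcset x0 y0).
    exists i, j, x0, y0; split=> //.
    - exact: arc_cls (arc_ang (cls (y j)) (cls (y i))).
    - by rewrite lerDl ang_ge0 ltrD2l ang_lt.
    rewrite y0x0; exists (arc_ang (cls (y j)) (cls (y i))), (c i j); split=> //.
    by rewrite gen_ang [RHS]mulr1.
  have [J [dJ JI Jmin]] := minimal_depth_interval dI.
  have [|z zJ] := FX J.
    by exists n, (fun i => cls (y i)), a, n, (fun i => cls (y i)), b.
  have [||m [x0z zy0]] := arcset_sub _ _ (subset_trans zJ JI).
  - by case/andP: (phi_bound z).
  - by rewrite ltrD2l ang_lt.
  rewrite -y0x0 lerD2r; apply: le_trans zy0; rewrite -phi_periodz//.
  by rewrite (phi_mono phi_homeo phi_period).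
have lv i : liftable (fd X _ (v i)).
  have /= <- := mor_eq ab (fd X _ (v i)); apply: liftable_mor.
  rewrite [b _ _]dsum_decomp; apply: liftable_sum => j.
  apply: (liftable_mor (inj j)); exact: P_liftable (c_small i j).
move=> z w; have /= <- := mor_eq ab w; set u := b _ w.
rewrite [a _ u]dsum_morE linear_sum; apply: liftable_sum => i /=.
rewrite -/(inj i) -[a _ _]/(mor_comp a (inj i) _ (u i)) [mor_comp a _]P_morE.
rewrite from_gen_ang linearZ /=; apply: liftableZ; rewrite -mfun_nat.
exact: liftable_ract (lv i).
Qed.

End Lifts.

(** * The additive structure of F_phi *)

Section ExactStructure.
Context (K : realType) (R : idomainType) (t : R) (phi : K -> K).
Local Notation S1 := (S1 K).
Local Notation rep := (rep K t).
Local Notation Prep := (Prep t).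
Local Notation fpi := (fpi K t).
Local Notation Fphi := (Fphi_cat t phi).
Local Notation conf := (@Fphi_exact K R t phi).
Context (phi_homeo : homeomorphism phi)
  (phi_period : forall x : K, phi (x + 2 * pi) = phi x + 2 * pi)
  (phi_bound : forall x : K, x <= phi x < x + pi).
Context (R_dvr : is_dvr R) (t_unif : is_uniformizer t).
Local Notation d_liftable := (d_liftable phi_bound).
Local Notation liftable := (liftable phi_bound).

Definition Fphi_obj (X : fpi) (lX : d_liftable X) : Fphi :=
  exist _ X (d_liftable_in_Fphi t_unif lX).

Lemma Fphi_lift (X : Fphi) : d_liftable (sval X).
Proof. exact: in_Fphi_d_liftable (svalP X). Qed.

Lemma fmorD (X Y : fpi) (f : fpi_mor X Y) p v : fmor f p (fd X p v) = fd Y p (fmor f p v).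
Proof. exact: (mor_eq (fmor_d f)). Qed.

Lemma fpi_torsion_free (X : fpi) : torsion_free X.
Proof.
exact: fg_projective_torsion_free (uniformizer_neq0 R_dvr t_unif) _
  (@frep_fg _ _ _ X) (@frep_proj _ _ _ X).
Qed.

Lemma epi_section (V W : rep) (f : mor V W) : projective W -> epi f ->
  exists s, mor_comp f s = mor_id W.
Proof. by move=> pW ef; exact: pW. Qed.

Definition generates (V : rep) n (b : 'I_n -> {p : S1 & V p}) :=
  forall q (u : V q), exists c : 'I_n -> R,
    u = \sum_i c i *: ract (arc_ang (tag (b i)) q) (tagged (b i)).

Lemma fg_generates (V : rep) :
  finitely_generated V <-> exists n (b : 'I_n -> {p : S1 & V p}), generates b.
Proof.
split=> [[n [x [f ef]]]|[n [b bP]]].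
  exists n, (fun i => Tagged (fun p => V p)
    (f (x i) (dsum_inj (fun i => Prep (x i)) i (x i) (gen t (arc0 (x i)))))) => q u.
  have [c <-] := ef q u; exists c; rewrite dsum_morE; apply: eq_bigr => i _.
  by rewrite [mor_comp f _]P_morE.
exists n, (fun i => tag (b i)), (dsum_copair (fun i => from_gen (tagged (b i)))) => q u.
by have [c ->] := bP q u; exists c; rewrite dsum_copairE.
Qed.

Lemma rsum_finitely_generated (V W : rep) :
  finitely_generated V -> finitely_generated W -> finitely_generated (rsum V W).
Proof.
move=> /fg_generates[m [b bP]] /fg_generates[n [c cP]]; apply/fg_generates.
exists (m + n)%N, (fun i => match split i with
  | inl k => Tagged (fun p => rsum V W p) ((tagged (b k), 0) : rsum V W (tag (b k)))
  | inr l => Tagged (fun p => rsum V W p) ((0, tagged (c l)) : rsum V W (tag (c l))) end).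
move=> q [v w]; have [r vE] := bP q v; have [s wE] := cP q w.
exists (fun i => match split i with inl k => r k | inr l => s l end).
rewrite big_split_ord /=.
under eq_bigr do rewrite (unsplitK (inl _)) /=.
under [X in _ + X]eq_bigr do rewrite (unsplitK (inr _)) /=.
have suml (F : 'I_m -> V q) : \sum_k ((F k, 0) : rsum V W q) = (\sum_k F k, 0).
  apply/esym/(big_morph (fun u : V q => ((u, 0) : rsum V W q))) => // u u'.
  by congr (_, _); rewrite addr0.
have sumr (F : 'I_n -> W q) : \sum_k ((0, F k) : rsum V W q) = (0, \sum_k F k).
  apply/esym/(big_morph (fun u : W q => ((0, u) : rsum V W q))) => // u u'.
  by congr (_, _); rewrite addr0.
transitivity ((v, 0) + (0, w) : rsum V W q).
  by rewrite -[RHS]/((_, _)) addr0 add0r.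
congr (_ + _).
  rewrite vE -suml; apply: eq_bigr => k _.
  by rewrite -[RHS]/((_, _)) linear0 scaler0.
rewrite wE -sumr; apply: eq_bigr => k _.
by rewrite -[RHS]/((_, _)) linear0 scaler0.
Qed.

Program Definition fpi_sum (X Y : fpi) : fpi :=
  @Fpi K R t (rsum X Y)
    (rsum_finitely_generated (@frep_fg _ _ _ X) (@frep_fg _ _ _ Y))
    (rsum_projective (@frep_proj _ _ _ X) (@frep_proj _ _ _ Y))
    (mor_pair (mor_comp (fd X) (mor_fst X Y)) (mor_comp (fd Y) (mor_snd X Y))) _.
Next Obligation. by move=> X Y p [v w]; congr (_, _); exact: fd_sqr. Qed.

Lemma liftable_pair (V W : rep) x (v : V (cls x)) (w : W (cls x)) :
  liftable v -> liftable w -> liftable ((v, w) : rsum V W (cls x)).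
Proof. by move=> [v' <-] [w' <-]; exists (v', w'). Qed.

Lemma fpi_sum_liftable X Y : d_liftable X -> d_liftable Y -> d_liftable (fpi_sum X Y).
Proof. by move=> lX lY x [v w]; apply: liftable_pair; [exact: lX|exact: lY]. Qed.

Lemma Fphi_biproduct (X Y : Fphi) : exists S, is_biproduct S X Y.
Proof.
exists (Fphi_obj (fpi_sum_liftable (@Fphi_lift X) (@Fphi_lift Y))).
have i1d : mor_comp (mor_pair (mor_id (sval X)) (0 : mor (sval X) (sval Y))) (fd (sval X)) =
    mor_comp (fd (fpi_sum (sval X) (sval Y))) (mor_pair (mor_id (sval X)) 0).
  by apply: morP => p v; congr (_, _); rewrite /= linear0.
have i2d : mor_comp (mor_pair (0 : mor (sval Y) (sval X)) (mor_id (sval Y))) (fd (sval Y)) =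
    mor_comp (fd (fpi_sum (sval X) (sval Y))) (mor_pair 0 (mor_id (sval Y))).
  by apply: morP => p v; congr (_, _); rewrite /= linear0.
have p1d : mor_comp (mor_fst (sval X) (sval Y)) (fd (fpi_sum (sval X) (sval Y))) =
    mor_comp (fd (sval X)) (mor_fst (sval X) (sval Y)) by exact: morP.
have p2d : mor_comp (mor_snd (sval X) (sval Y)) (fd (fpi_sum (sval X) (sval Y))) =
    mor_comp (fd (sval Y)) (mor_snd (sval X) (sval Y)) by exact: morP.
pose S := fpi_sum (sval X) (sval Y).
exists (@FpiMor _ _ _ (sval X) S _ i1d), (@FpiMor _ _ _ (sval Y) S _ i2d),
  (@FpiMor _ _ _ S (sval X) _ p1d), (@FpiMor _ _ _ S (sval Y) _ p2d).
split; apply: fpi_morP; apply: morP => // p [v w].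
by rewrite -[LHS]/((_, _)) addr0 add0r.
Qed.

Definition rep0 : rep := dsum (fun i : 'I_0 => (Prep (cls 0))).

Lemma rep0_eq p (u v : rep0 p) : u = v.
Proof. by apply: functional_extensionality_dep => -[]. Qed.

Lemma rep0_fg : finitely_generated rep0.
Proof. by exists 0%N, (fun=> cls 0), (mor_id rep0) => p v; exists v. Qed.

Lemma rep0_projective : projective rep0.
Proof.
move=> V W g f _; have z : mor rep0 V by exact: 0.
by exists z; apply: morP => p v; rewrite (rep0_eq v 0) !linear0.
Qed.

Lemma Fphi_zero : exists Z : Fphi, is_zero Z.
Proof.
pose Z := @Fpi K R t rep0 rep0_fg rep0_projective 0 (fun p v => rep0_eq _ _).
have lZ : d_liftable Z by move=> x v; exact: liftable0.
by exists (Fphi_obj lZ); apply: fpi_morP; apply: morP => p v; exact: rep0_eq.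
Qed.

(** * Conflations, inflations and deflations *)

(** With a section s of p as representations, the kernel of p is the image
   of the idempotent 1 - s p; it is stable under d. *)
Lemma kernel_exists (Y Z : Fphi) (p : hom Y Z) :
  epi (fmor p) -> exists (X : Fphi) (i : hom X Y), conf i p.
Proof.
move=> ep; have [s ps] := epi_section (@frep_proj _ _ _ (sval Z)) ep.
have {}ps q v : fmor p q (s q v) = v by exact: (mor_eq ps).
pose e : mor (sval Y) (sval Y) := mor_id _ - mor_comp s (fmor p).
have eE q v : e q v = v - s q (fmor p q v) by [].
have pe q v : fmor p q (e q v) = 0 by rewrite eE linearB /= ps subrr.
have ek q v : fmor p q v = 0 -> e q v = v.
  by move=> pv; rewrite eE pv linear0 subr0.
have ee : mor_comp e e = e by apply: morP => q v; exact: ek.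
have [W [i [r [ri ir]]]] := split_idempotent ee.
have {}ri q v : r q (i q v) = v by exact: (mor_eq ri).
have {}ir q v : i q (r q v) = e q v by exact: (mor_eq ir).
have pi q v : fmor p q (i q v) = 0 by rewrite -[v]ri ir pe.
have WY : rep_retract W (sval Y) by exists i, r; exact: morP.
have id q v : i q (r q (fd (sval Y) q (i q v))) = fd (sval Y) q (i q v).
  by rewrite ir ek// fmorD pi linear0.
have sq q v : mor_comp r (mor_comp (fd (sval Y)) i) q
    (mor_comp r (mor_comp (fd (sval Y)) i) q v) = t *: v.
  by rewrite /= id fd_sqr linearZ /= ri.
pose X := @Fpi K R t W (rep_retract_fg WY (@frep_fg _ _ _ _))
  (rep_retract_projective WY (@frep_proj _ _ _ _)) _ sq.
have lX : d_liftable X by move=> x v; apply: (liftable_mor r); exact: Fphi_lift.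
have i_d : mor_comp i (fd X) = mor_comp (fd (sval Y)) i by apply: morP => q v; exact: id.
exists (Fphi_obj lX), (@FpiMor _ _ _ X (sval Y) i i_d); split=> // q.
  by move=> u v uv; rewrite -[u]ri -[v]ri; congr (r q _).
move=> v; split=> [pv|[u <-]]; last exact: pi.
by exists (r q v); rewrite /= ir ek.
Qed.

(** The complement of the image of i given by r need not be stable under d;
   composing d with the projection 1 - i r gives the action on the quotient. *)
Lemma cokernel_exists (X Y : Fphi) (i : hom X Y) (r : mor (sval Y) (sval X)) :
  mor_comp r (fmor i) = mor_id _ -> exists (Z : Fphi) (p : hom Y Z), conf i p.
Proof.
move=> ri; have {}ri q v : r q (fmor i q v) = v by exact: (mor_eq ri).
pose e : mor (sval Y) (sval Y) := mor_id _ - mor_comp (fmor i) r.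
have eE q v : e q v = v - fmor i q (r q v) by [].
have re q v : r q (e q v) = 0 by rewrite eE linearB /= ri subrr.
have ei q v : e q (fmor i q v) = 0 by rewrite eE ri subrr.
have ee : mor_comp e e = e.
  by apply: morP => q v /=; rewrite [LHS]eE re linear0 subr0.
have [W [j [p [pj jp]]]] := split_idempotent ee.
have {}pj q v : p q (j q v) = v by exact: (mor_eq pj).
have {}jp q v : j q (p q v) = e q v by exact: (mor_eq jp).
have pi q v : p q (fmor i q v) = 0 by rewrite -[LHS]pj jp ei linear0.
have WY : rep_retract W (sval Y) by exists j, p; exact: morP.
have pd q v : p q (fd (sval Y) q (j q (p q v))) = p q (fd (sval Y) q v).
  by rewrite jp eE !linearB /= -fmorD pi subr0.
have sq q v : mor_comp p (mor_comp (fd (sval Y)) j) q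
    (mor_comp p (mor_comp (fd (sval Y)) j) q v) = t *: v.
  by rewrite /= pd fd_sqr linearZ /= pj.
pose Z := @Fpi K R t W (rep_retract_fg WY (@frep_fg _ _ _ _))
  (rep_retract_projective WY (@frep_proj _ _ _ _)) _ sq.
have lZ : d_liftable Z by move=> x v; apply: (liftable_mor p); exact: Fphi_lift.
have p_d : mor_comp p (fd (sval Y)) = mor_comp (fd Z) p.
  by apply: morP => q v; rewrite /= pd.
exists (Fphi_obj lZ), (@FpiMor _ _ _ (sval Y) Z p p_d); split=> q.
- by move=> u v uv; rewrite -[u]ri -[v]ri uv.
- move=> v; split=> [pv|[u <-]]; last exact: pi.
  exists (r q v); apply/esym/eqP; rewrite -subr_eq0 -eE -jp.
  by move: pv => /= ->; rewrite linear0.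
- by move=> v; exists (j q v); exact: pj.
Qed.

Lemma conf_retraction (X Y Z : Fphi) (i : hom X Y) (p : hom Y Z) : conf i p ->
  exists (r : mor (sval Y) (sval X)) (s : mor (sval Z) (sval Y)),
    [/\ forall q v, r q (fmor i q v) = v, forall q v, fmor p q (s q v) = v
      & forall q v, fmor i q (r q v) + s q (fmor p q v) = v].
Proof.
move=> [inj ex ep]; have [s ps] := epi_section (@frep_proj _ _ _ (sval Z)) ep.
have {}ps q v : fmor p q (s q v) = v by exact: (mor_eq ps).
have [||r ir] := @mor_factor _ _ _ (sval Y) (sval X) _ (fmor i) (mor_id _ - mor_comp s (fmor p)).
- exact: inj.
- by move=> q v; apply: (proj1 (ex _ _)); rewrite linearB /= ps subrr.
have {}ir q v : fmor i q (r q v) = v - s q (fmor p q v) by exact: (mor_eq ir).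
exists r, s; split=> // q v; last by rewrite ir subrK.
have pi : fmor p q (fmor i q v) = 0 by apply/(proj2 (ex _ _)); exists v.
by apply: inj; rewrite ir pi linear0 subr0.
Qed.

Lemma inflationE (X Y : Fphi) (i : hom X Y) : inflation conf i <->
  exists r : mor (sval Y) (sval X), mor_comp r (fmor i) = mor_id _.
Proof.
split=> [[Z [p /conf_retraction[r [s [ri _ _]]]]]|[r /cokernel_exists[Z [p ip]]]].
  by exists r; exact: morP.
by exists Z, p.
Qed.

Lemma deflationE (Y Z : Fphi) (p : hom Y Z) : deflation conf p <-> epi (fmor p).
Proof. by split=> [[X [i [_ _]]]|/kernel_exists[X [i ip]]]; last exists X, i. Qed.

Lemma conf_kernel (X Y Z : Fphi) (i : hom X Y) (p : hom Y Z) :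
  conf i p -> is_kernel i p.
Proof.
move=> ip; have [r [s [ri ps irs]]] := conf_retraction ip; case: ip => inj ex ep.
split=> [|T h ph].
  by apply: fpi_morP; apply: morP => q v; apply: (proj2 (ex _ _)); exists v.
have irh q v : fmor i q (r q (fmor h q v)) = fmor h q v.
  have := irs q (fmor h q v); have /= -> := mor_eq (congr1 (@fmor _ _ _ _ _) ph) v.
  by rewrite linear0 addr0.
have kd : mor_comp (mor_comp r (fmor h)) (fd (sval T)) =
    mor_comp (fd (sval X)) (mor_comp r (fmor h)).
  by apply: morP => q v; apply: inj; rewrite /= irh !fmorD irh.
exists (FpiMor kd); split.
  by apply: fpi_morP; apply: morP => q v; exact: irh.
move=> k ik; apply: fpi_morP; apply: morP => q v; apply: inj => /=.
by rewrite irh -ik.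
Qed.

Lemma conf_cokernel (X Y Z : Fphi) (i : hom X Y) (p : hom Y Z) :
  conf i p -> is_cokernel i p.
Proof.
move=> ip; have [r [s [ri ps irs]]] := conf_retraction ip; case: ip => inj ex ep.
split=> [|T h hi].
  by apply: fpi_morP; apply: morP => q v; apply: (proj2 (ex _ _)); exists v.
have hsp q v : fmor h q (s q (fmor p q v)) = fmor h q v.
  rewrite -{2}[v]irs linearD /=; have /= -> := mor_eq (congr1 (@fmor _ _ _ _ _) hi) (r q v).
  by rewrite add0r.
have kd : mor_comp (mor_comp (fmor h) s) (fd (sval Z)) =
    mor_comp (fd (sval T)) (mor_comp (fmor h) s).
  by apply: morP => q v; rewrite /= -{1}[v]ps -(fmorD p) hsp fmorD.
exists (FpiMor kd); split.
  by apply: fpi_morP; apply: morP => q v; exact: hsp.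
move=> k kp; apply: fpi_morP; apply: morP => q v /=.
by rewrite -kp /= ps.
Qed.

End ExactStructure.

(** * Quillen's axioms *)

Section ExactCategory.
Context (K : realType) (R : idomainType) (t : R) (phi : K -> K).
Local Notation Fphi := (Fphi_cat t phi).
Local Notation conf := (@Fphi_exact K R t phi).
Context (phi_homeo : homeomorphism phi)
  (phi_period : forall x : K, phi (x + 2 * pi) = phi x + 2 * pi)
  (phi_bound : forall x : K, x <= phi x < x + pi).
Context (R_dvr : is_dvr R) (t_unif : is_uniformizer t).

Lemma hom_eq (X Y : Fphi) (f g : hom X Y) : f = g -> forall p v, fmor f p v = fmor g p v.
Proof. by move=> ->. Qed.

Lemma hom_ext (X Y : Fphi) (f g : hom X Y) : (forall p v, fmor f p v = fmor g p v) -> f = g.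
Proof. by move=> e; apply: fpi_morP; exact: morP. Qed.

Let biproducts := Fphi_biproduct phi_homeo phi_period phi_bound R_dvr t_unif.
Let kernels := kernel_exists phi_homeo phi_period phi_bound R_dvr t_unif.
Let cokernels := cokernel_exists phi_homeo phi_period phi_bound R_dvr t_unif.
Let inflP := inflationE phi_homeo phi_period phi_bound R_dvr t_unif.
Let deflP := deflationE phi_homeo phi_period phi_bound R_dvr t_unif.

(** If r is a retraction of i, then p2 + f r p1 vanishes on the image of (i, -f),
   and so gives a retraction of i'. *)
Lemma pushout_inflation (A B A' : Fphi) (i : hom A B) (f : hom A A') :
  inflation conf i -> exists (B' : Fphi) (i' : hom A' B') (f' : hom B B'),
    is_pushout i f i' f' /\ inflation conf i'.
Proof.
move=> /inflP[r ri].
have [S [i1 [i2 [p1 [p2 [e1 e2 e12 e21 es]]]]]] := biproducts B A'.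
pose m : hom A S := comp i1 i - comp i2 f.
have p1m : comp p1 m = i by rewrite compmB !compA e1 e12 comp1m comp0m subr0.
have p2m : comp p2 m = - f by rewrite compmB !compA e2 e21 comp1m comp0m sub0r.
have [B' [c mc]] : exists (B' : Fphi) (c : hom S B'), conf m c.
  apply: (@cokernels _ _ m (mor_comp r (fmor p1))); apply: morP => q v.
  by have /= -> := hom_eq p1m v; exact: (mor_eq ri).
have [r' [s [rm cs mrs]]] := conf_retraction mc.
have [cm0 cP] := conf_cokernel mc.
exists B', (comp c i2), (comp c i1); split; last first.
  apply/inflP; exists (mor_comp (fmor p2 + mor_comp (fmor f) (mor_comp r (fmor p1))) s).
  set rho := fmor p2 + _.
  have rhoE q v : rho q v = fmor p2 q v + fmor f q (r q (fmor p1 q v)) by [].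
  clearbody rho; have rhom q v : rho q (fmor m q v) = 0.
    rewrite rhoE; have /= -> := hom_eq p1m v; have /= -> := hom_eq p2m v.
    have /= -> := mor_eq ri v; exact: addNr.
  apply: morP => q v /=; have := mrs q (fmor i2 q v).
  move=> /(congr1 (rho q)); rewrite linearD /= rhom add0r => ->.
  rewrite rhoE; have /= -> := hom_eq e2 v; have /= -> := hom_eq e12 v.
  by rewrite !linear0 addr0.
split.
  by apply/eqP; rewrite eq_sym -subr_eq0 -!compA -compmB cm0.
move=> T u v uv; pose h : hom S T := comp v p1 + comp u p2.
have hm : comp h m = 0 by rewrite compDl -!compA p1m p2m compmN -uv subrr.
have [k [kc kP]] := cP T h hm.
exists k; split.
  rewrite !compA kc !compDl -!compA e1 e2 e12 e21 !compm0 !compm1.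
  by rewrite addr0 add0r.
move=> k' [k'u k'v]; apply: kP.
by rewrite -[comp k' c]compm1 -es compDr !compA -(compA k') k'v -(compA k') k'u.
Qed.

Lemma pullback_deflation (B D D' : Fphi) (p : hom B D) (f : hom D' D) :
  deflation conf p -> exists (B' : Fphi) (p' : hom B' D') (f' : hom B' B),
    is_pullback p f p' f' /\ deflation conf p'.
Proof.
move=> /deflP ep.
have [S [i1 [i2 [p1 [p2 [e1 e2 e12 e21 es]]]]]] := biproducts B D'.
pose m : hom S D := comp p p1 - comp f p2.
have mi1 : comp m i1 = p by rewrite compBm -!compA e1 e21 compm1 compm0 subr0.
have mi2 : comp m i2 = - f by rewrite compBm -!compA e2 e12 compm1 compm0 sub0r.
have [B' [k km]] : exists (B' : Fphi) (k : hom B' S), conf k m.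
  apply: kernels => q d; have [b <-] := ep q d; exists (fmor i1 q b).
  exact: (hom_eq mi1).
have [mk0 kP] := conf_kernel km; case: km => _ kex _.
exists B', (comp p2 k), (comp p1 k); split; last first.
  apply/deflP => q d; have [b bd] := ep q (fmor f q d).
  have [|w kw] := proj1 (kex q (fmor i1 q b + fmor i2 q d)).
    rewrite linearD /=; have /= -> := hom_eq mi1 b; have /= -> := hom_eq mi2 d.
    by rewrite bd; exact: subrr.
  exists w => /=; rewrite kw linearD /=; have /= -> := hom_eq e21 b.
  by have /= -> := hom_eq e2 d; rewrite add0r.
split.
  by apply/eqP; rewrite -subr_eq0 !compA -compBm mk0.
move=> T u v uv; pose h : hom T S := comp i1 u + comp i2 v.
have mh : comp m h = 0 by rewrite compDr !compA mi1 mi2 compNm -uv subrr.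
have [g [kg gP]] := kP T h mh.
exists g; split.
  rewrite -!compA kg !compDr !compA e1 e2 e12 e21 !comp0m !comp1m.
  by rewrite addr0 add0r.
move=> g' [g'u g'v]; apply: gP.
by rewrite -[comp k g']comp1m -es compDl -!compA (compA p1) g'u (compA p2) g'v.
Qed.

Lemma Fphi_exact_category : exact_category conf.
Proof.
split.
- by split; [exact: (Fphi_zero (phi := phi) phi_bound t_unif)|exact: biproducts].
- by move=> A B D i p ip; split; [exact: conf_kernel ip|exact: conf_cokernel ip].
- move=> A B D A' B' D' i p i' p' a b d [a' [aK aK']] [b' [bK bK']] [d' [dK dK']] bi dp.
  move=> [inj ex ep]; split=> q.
  + move=> u v uv; have /= <- := hom_eq aK' u; have /= <- := hom_eq aK' v.
    congr (fmor a q _); apply: inj.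
    have /= <- := hom_eq bK (fmor i q (fmor a' q u)).
    have /= <- := hom_eq bK (fmor i q (fmor a' q v)).
    have /= -> := hom_eq bi (fmor a' q u); have /= -> := hom_eq bi (fmor a' q v).
    by have /= -> := hom_eq aK' u; have /= -> := hom_eq aK' v; rewrite uv.
  + move=> v; split=> [pv|[u <-]].
      have [|u uE] := proj1 (ex q (fmor b' q v)).
        have /= <- := hom_eq dK (fmor p q (fmor b' q v)).
        have /= -> := hom_eq dp (fmor b' q v); have /= -> := hom_eq bK' v.
        by rewrite pv linear0.
      exists (fmor a q u); have /= <- := hom_eq bi u; rewrite uE.
      exact: (hom_eq bK').
    have /= <- := hom_eq aK' u; have /= <- := hom_eq bi (fmor a' q u).
    have /= <- := hom_eq dp (fmor i q (fmor a' q u)).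
    by rewrite (proj2 (ex q _)) ?linear0//; exists (fmor a' q u).
  + move=> w; have [v vE] := ep q (fmor d' q w); exists (fmor b q v).
    by have /= <- := hom_eq dp v; rewrite vE; exact: (hom_eq dK').
- by move=> A; apply/inflP; exists (mor_id _); exact: morP.
- by move=> A; apply/deflP => q v; exists v.
- move=> A B D i j /inflP[r ri] /inflP[s sj]; apply/inflP; exists (mor_comp r s).
  by apply: morP => q v /=; have /= -> := mor_eq sj (fmor i q v); exact: (mor_eq ri).
- move=> A B D p r /deflP ep /deflP er; apply/deflP => q w.
  by have [v <-] := er q w; have [u <-] := ep q v; exists u.
- by move=> A B A' i f; exact: pushout_inflation.
- by move=> B D D' p f; exact: pullback_deflation.
Qed.

End ExactCategory.

(** * The objects E(x, phi x) *)

Section PhiObjects.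
Context (K : realType) (R : idomainType) (t : R) (phi : K -> K).
Local Notation S1 := (S1 K).
Local Notation rep := (rep K t).
Local Notation Prep := (Prep t).
Local Notation fpi := (fpi K t).
Local Notation Fphi := (Fphi_cat t phi).
Local Notation conf := (@Fphi_exact K R t phi).
Context (phi_homeo : homeomorphism phi)
  (phi_period : forall x : K, phi (x + 2 * pi) = phi x + 2 * pi)
  (phi_bound : forall x : K, x <= phi x < x + pi).
Context (R_dvr : is_dvr R) (t_unif : is_uniformizer t).
Local Notation d_liftable := (d_liftable phi_bound).
Local Notation liftable := (liftable phi_bound).
Local Notation dlift := (Fphi_lift phi_homeo phi_period phi_bound R_dvr t_unif).
Local Notation torsion X := (@fpi_torsion_free K R t R_dvr t_unif X).

Lemma gen_liftable p y a (h : arc p (cls y) a) : phi y - y <= a -> liftable (gen t h).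
Proof.
move=> ya; have h' : arc p (cls (phi y)) (a - (phi y - y)).
  case/andP: h => _; rewrite /arc subr_ge0 ya => /eqP/esym pa /=.
  by rewrite -rotD pa rot_cls opprK addrC subrK.
exists (gen t h').
rewrite (ract_gen t h' (phi_arc phi_bound y) (arcD h' (phi_arc phi_bound y))).
by rewrite /gen addrC subrK.
Qed.

Lemma from_P_liftable (V : rep) x (f : mor (Prep (cls x)) V) :
  liftable (f _ (gen t (arc0 (cls x)))) -> forall y v, liftable (f (cls y) v).
Proof.
move=> lf y v; rewrite [f]P_morE from_gen_ang; apply: liftableZ.
exact: liftable_ract lf.
Qed.

Lemma starE (p q : S1) a (h : arc q p a) : star t h p (gen t (arc0 p)) = gen t h.
Proof. exact: from_gen_gen. Qed.

Lemma Eobj_liftable x y (h : x <= y <= x + 2 * pi) :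
  phi x <= y -> phi y <= x + 2 * pi -> d_liftable (Eobj t h).
Proof.
move=> xy yx z [v w]; apply: liftable_pair; apply: from_P_liftable;
  rewrite starE; apply: gen_liftable; rewrite lerD2r//.
Qed.

Lemma phi_itv x : x <= phi x <= x + 2 * pi.
Proof. by have /andP[-> h] := phi_bound x; have := pi_gt0 K; lra. Qed.

Lemma phi2_le x : phi (phi x) <= x + 2 * pi.
Proof. by have /andP[_ h] := phi_bound (phi x); have /andP[_ h'] := phi_bound x; lra. Qed.

Definition Efpi x : fpi := Eobj t (phi_itv x).
Definition Ephi x : Fphi :=
  Fphi_obj t_unif (Eobj_liftable (h := phi_itv x) (lexx _) (phi2_le x)).

Local Notation al x := (E_alpha (phi_itv x)).
Local Notation be x := (E_beta (phi_itv x)).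
Local Notation e1 x := ((gen t (arc0 (cls x)), 0) : Efpi x (cls x)).
Local Notation e2 x := ((0, gen t (arc0 (cls (phi x)))) : Efpi x (cls (phi x))).

Lemma Efpi_d1 x : fd (Efpi x) _ (e1 x) = ract (al x) (e2 x).
Proof.
congr (_, _); first by rewrite /= scale0r mulr0.
transitivity (star t (al x) (cls x) (gen t (arc0 (cls x)))); first by [].
rewrite starE (ract_gen t (arc0 (cls (phi x))) (al x) (arcD (arc0 (cls (phi x))) (al x))).
by rewrite /gen addr0.
Qed.

Lemma ract_al_be (V : rep) x (v : V (cls x)) : ract (al x) (ract (be x) v) = t *: v.
Proof.
rewrite (ract_comp (be x) (al x) (arcD (be x) (al x))).
rewrite (ract_eq _ (arc_loop (cls x) 1)) ?ract_loop ?expr1//.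
ring.
Qed.

(** The two generators of E(x, phi x) are denoted by e1 and e2, and d e1 is the
   image of e2 in E[x]. So e1 goes to v, and e2 to the vector w of X[phi x] above
   d v; the image of d e2 is then right as well, because it is right after the
   injective map from X[phi x] to X[x]. *)
Lemma Ephi_hom (X : Fphi) x (v : sval X (cls x)) :
  exists g : hom (Ephi x) X, fmor g (cls x) (e1 x) = v.
Proof.
have [w wE] := dlift v.
have alw : ract (al x) w = fd (sval X) _ v by rewrite -wE; exact: ract_eq.
have bev : ract (be x) v = fd (sval X) _ w.
  apply: (ract_inj (h := al x) (torsion (sval X))).
  by rewrite ract_al_be mfun_nat alw fd_sqr.
pose f := mor_comp (from_gen v) (mor_fst (Prep (cls x)) (Prep (cls (phi x)))) +
  mor_comp (from_gen w) (mor_snd (Prep (cls x)) (Prep (cls (phi x)))).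
have f1 : mor_comp (from_gen w) (star t (al x)) = mor_comp (fd (sval X)) (from_gen v).
  by apply: P_mor_eq; rewrite !mor_compE starE from_genE from_gen_gen.
have f2 : mor_comp (from_gen v) (star t (be x)) = mor_comp (fd (sval X)) (from_gen w).
  by apply: P_mor_eq; rewrite !mor_compE starE from_genE from_gen_gen.
have fdE : mor_comp f (fd (Efpi x)) = mor_comp (fd (sval X)) f.
  apply: morP => q [a b]; rewrite !mor_compE /f !mor_addE linearD addrC.
  by congr (_ + _); [exact: (mor_eq f1)|exact: (mor_eq f2)].
exists (@FpiMor _ _ _ (Efpi x) (sval X) f fdE).
by rewrite [LHS]mor_addE !mor_compE from_gen_gen linear0 addr0.
Qed.

Lemma Ephi_hom_eq (X : Fphi) x (f g : hom (Ephi x) X) :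
  fmor f (cls x) (e1 x) = fmor g (cls x) (e1 x) -> f = g.
Proof.
move=> e.
have e' : fmor f _ (e2 x) = fmor g _ (e2 x).
  apply: (ract_inj (h := al x) (torsion (sval X))).
  by rewrite !mfun_nat -Efpi_d1 !fmorD e.
pose i1 : mor (Prep (cls x)) (Efpi x) :=
  mor_pair (mor_id (Prep (cls x))) (0 : mor (Prep (cls x)) (Prep (cls (phi x)))).
pose i2 : mor (Prep (cls (phi x))) (Efpi x) :=
  mor_pair (0 : mor (Prep (cls (phi x))) (Prep (cls x))) (mor_id (Prep (cls (phi x)))).
have E1 : mor_comp (fmor f) i1 = mor_comp (fmor g) i1 by exact: P_mor_eq.
have E2 : mor_comp (fmor f) i2 = mor_comp (fmor g) i2 by exact: P_mor_eq.
apply: hom_ext => q [a b].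
have -> : (a, b) = i1 q a + i2 q b by congr (_, _); rewrite ?addr0 ?add0r.
rewrite !linearD; congr (_ + _); [exact: (mor_eq E1)|exact: (mor_eq E2)].
Qed.

Lemma Ephi_projective x : ex_projective conf (Ephi x).
Proof.
move=> B D p f /(deflationE phi_homeo phi_period phi_bound R_dvr t_unif) ep.
have [u uE] := ep _ (fmor f _ (e1 x)).
have [g gE] := Ephi_hom u; exists g; apply: Ephi_hom_eq.
by rewrite -uE -gE.
Qed.

Lemma star_al_inj x q : injective (@mfun _ _ _ _ _ (star t (al x)) q).
Proof.
move=> a b; rewrite /star !from_gen_ang => ab.
have : (a - b) * ract (arc_ang (cls x) q) (gen t (al x)) = 0.
  by move/eqP: ab; rewrite -subr_eq0 -scalerBl => /eqP.
move=> /eqP; rewrite mulf_eq0 subr_eq0 => /orP[/eqP//|].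
rewrite mulf_eq0 !expf_eq0 (negbTE (uniformizer_neq0 R_dvr t_unif)).
by rewrite !andbF.
Qed.

(** The generator of P_[phi x] at phi y has some depth a, and phi x - a = phi z for
   a lift z of the class of y. Its image at y has depth phi x - z >= phi x - x, and
   so comes from P_[x]. *)
Lemma star_al_lift x y (c : Prep (cls (phi x)) (cls (phi y))) :
  exists u, star t (al x) (cls y) u = ract (phi_arc phi_bound y) c.
Proof.
have [psi [can1 can2]] := phi_cancel phi_homeo.
pose a := ang (cls (phi x)) (cls (phi y)).
have phiz : phi (psi (phi x - a)) = phi x - a by rewrite can2.
set z := psi (phi x - a) in phiz.
have := arc_ang (cls (phi x)) (cls (phi y)); rewrite -/a => ha.
have [m yE] : exists m : int, y = z + 2 * pi * m%:~R.
  case/andP: (ha) => _; rewrite rot_cls -phiz => /eqP/clsE[m].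
  by rewrite -phi_periodz// => /(can_inj can1) ->; exists m.
have zx : z <= x.
  by rewrite -(phi_mono phi_homeo phi_period) phiz gerBl; case/andP: ha.
have hz : arc (cls x) (cls y) (x - z) by rewrite yE cls_shift; exact: cls_arc.
exists (c *: gen t hz).
have -> : ract (phi_arc phi_bound y) c = (c : R) *:
    ract (phi_arc phi_bound y) (ract ha (gen t (arc0 (cls (phi x))))).
  by rewrite {1}[c]P_gen; exact: linearZ.
rewrite [LHS]linearZ; congr (_ *: _).
transitivity (ract hz (gen t (al x))); first exact: from_genE.
rewrite (ract_gen t (al x) hz (arcD (al x) hz)).
rewrite (ract_gen t (arc0 (cls (phi x))) ha (arcD (arc0 (cls (phi x))) ha)).
rewrite (ract_gen t (arcD (arc0 (cls (phi x))) ha) (phi_arc phi_bound y)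
  (arcD (arcD (arc0 (cls (phi x))) ha) (phi_arc phi_bound y))).
rewrite /gen; congr (t ^+ Num.truncn (_ / _)).
rewrite yE phi_periodz// phiz; ring.
Qed.

(** The second component G determines the first one, since the morphism from
   P_[x] to P_[phi x] is injective; the first one exists because G d factors
   through that morphism by the lifting condition on X. *)
Lemma Ephi_cohom (X : Fphi) x (G : mor (sval X) (Prep (cls (phi x)))) :
  exists g : hom X (Ephi x), forall q v, (fmor g q v).2 = G q v.
Proof.
have [||g1 g1E] := @mor_factor _ _ _ (sval X) _ _ (star t (al x)) (mor_comp G (fd (sval X))).
- exact: star_al_inj.
- move=> q v; have [y qE] : exists y, q = cls y by exists (repr q); rewrite cls_repr.
  subst q; have [w wE] := dlift v.
  have [u uE] := star_al_lift (G _ w); exists u.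
  by rewrite uE mfun_nat mor_compE -wE.
have gd : mor_comp (mor_pair g1 G) (fd (sval X)) = mor_comp (fd (Efpi x)) (mor_pair g1 G).
  apply: morP => q v; congr (_, _); last exact: esym (mor_eq g1E v).
  apply: (@star_al_inj x q); rewrite -mor_compE g1E mor_compE fd_sqr linearZ.
  by apply/esym/star_star; ring.
by exists (@FpiMor _ _ _ (sval X) (Efpi x) (mor_pair g1 G) gd).
Qed.

Lemma Ephi_cohom_eq (X : Fphi) x (f g : hom X (Ephi x)) :
  (forall q v, (fmor f q v).2 = (fmor g q v).2) -> f = g.
Proof.
move=> e; apply: hom_ext => q v; rewrite [LHS]surjective_pairing [RHS]surjective_pairing.
rewrite e; congr (_, _); apply: (@star_al_inj x q).
have := e q (fd (sval X) q v).
by have -> := fmorD f v; have -> := fmorD g v.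
Qed.

Lemma Ephi_injective x : ex_injective conf (Ephi x).
Proof.
move=> A B i f /(inflationE phi_homeo phi_period phi_bound R_dvr t_unif)[r ri].
have [g gE] := Ephi_cohom (mor_comp (mor_comp (mor_snd _ _) (fmor f)) r).
exists g; apply: Ephi_cohom_eq => q v; rewrite [LHS]gE /=.
by have /= -> := mor_eq ri v.
Qed.

Lemma Ephi_neq0 x : ~ is_zero (Ephi x).
Proof.
move=> /hom_eq/(_ (cls x) (e1 x)) /(congr1 fst) /= /eqP.
by rewrite gen0E oner_eq0.
Qed.

(** As E[x] is free on e1 and d e1, the endomorphism ring of E(x, phi x) is
   R[d]. *)
Lemma Ephi_end (x : K) (c : hom (Ephi x) (Ephi x)) : exists r s : R,
  fmor c _ (e1 x) = r *: e1 x + s *: fd (Efpi x) _ (e1 x).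
Proof.
have dE : fd (Efpi x) _ (e1 x) = (0, 1).
  rewrite Efpi_d1; congr (_, _); first exact: linear0.
  rewrite (ract_gen t (arc0 _) (al x) (arcD (arc0 _) (al x))) gen_lt// addr0.
  by have /andP[_ h] := phi_bound x; have := pi_gt0 K; lra.
rewrite dE; case: (fmor c _ (e1 x)) => [r s]; exists r, s; congr (_, _).
  by rewrite gen0E /= scaler0 addr0 [RHS]mulr1.
by rewrite /= scaler0 add0r [RHS]mulr1.
Qed.

(** In R[d] with d^2 = t, the inverse of r + s d is (r - s d) / (r^2 - s^2 t),
   which is defined as soon as r is a unit. *)
Lemma Ephi_end_left_inverse x (c : hom (Ephi x) (Ephi x)) (r s : R) :
  fmor c _ (e1 x) = r *: e1 x + s *: fd (Efpi x) _ (e1 x) ->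
  r \is a GRing.unit -> exists (g : hom (Ephi x) (Ephi x)) (r' s' : R),
    [/\ comp g c = idm _, fmor g _ (e1 x) = r' *: e1 x + s' *: fd (Efpi x) _ (e1 x)
      & r' \is a GRing.unit].
Proof.
move=> cE rU; set D := r ^+ 2 - s ^+ 2 * t.
have DU : D \is a GRing.unit.
  apply/negPn/negP => /(nunit_dvd R_dvr t_unif)[k kE].
  have r2 : r ^+ 2 = t * (k + s ^+ 2) by rewrite mulrDr -kE [t * _]mulrC subrK.
  have : r ^+ 2 \is a GRing.unit by rewrite unitrX.
  by rewrite r2 unitrM (negbTE (uniformizer_nunit t_unif)).
set u := e1 x in cE *; set du := fd (Efpi x) _ u in cE *.
have comb (V : lmodType R) (v w : V) E : r *: (E *: (r *: v - s *: w)) +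
    s *: (E *: (r *: w - (s * t) *: v)) = (E * (r ^+ 2 - s ^+ 2 * t)) *: v.
  rewrite !scalerBr !scalerA (_ : r * E * s = s * E * r); last by ring.
  by rewrite addrA subrK -scalerBl; congr (_ *: _); ring.
have [g gE'] := @Ephi_hom (Ephi x) x (D^-1 *: (r *: u - s *: du)).
have gE : fmor g _ u = D^-1 *: (r *: u - s *: du) := gE'.
have gdE : fmor g _ du = D^-1 *: (r *: du - (s * t) *: u).
  rewrite fmorD gE linearZ linearB; congr (_ *: (_ - _)); first exact: linearZ.
  by rewrite -scalerA -[t *: u]fd_sqr; exact: linearZ.
exists g, (D^-1 * r), (- (D^-1 * s)); split; last by rewrite unitrM unitrV DU.
  apply: Ephi_hom_eq; rewrite -[LHS]/(fmor g _ (fmor c _ u)) cE linearD !linearZ.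
  transitivity (r *: (D^-1 *: (r *: u - s *: du)) + s *: (D^-1 *: (r *: du - (s * t) *: u))).
    by congr (_ *: _ + _ *: _); [exact: gE|exact: gdE].
  by rewrite comb mulVr// scale1r.
by rewrite gE scalerBr !scalerA scaleNr.
Qed.

Lemma Ephi_end_iso x (c : hom (Ephi x) (Ephi x)) (r s : R) :
  fmor c _ (e1 x) = r *: e1 x + s *: fd (Efpi x) _ (e1 x) ->
  r \is a GRing.unit -> is_iso c.
Proof.
move=> cE rU; have [g [r' [s' [gc gE r'U]]]] := Ephi_end_left_inverse cE rU.
have [h [_ [_ [hg _ _]]]] := Ephi_end_left_inverse gE r'U.
exists g; split=> //; rewrite -[c]comp1m -hg -(compA h) gc.
by rewrite compm1.
Qed.

Lemma Ephi_local x : local_obj (Ephi x).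
Proof.
split; first exact: Ephi_neq0.
move=> c; have [r [s cE]] := Ephi_end c.
have [rU|rU] := unit_or_unit1B R_dvr t_unif r; [left|right].
  exact: Ephi_end_iso cE rU.
apply: (Ephi_end_iso (r := 1 - r) (s := - s)) rU.
rewrite -[LHS]/(e1 x - fmor c _ (e1 x)) cE scalerBl scale1r scaleNr.
by rewrite opprD addrA.
Qed.

(** * Enough projectives and injectives *)

Definition is_Ephi (E : Fphi) := exists x, E = Ephi x.

Lemma sum_of_Ephi_projective S : sum_of is_Ephi S -> ex_projective conf S.
Proof. by apply: sum_of_projective => _ [x ->]; exact: Ephi_projective. Qed.

Lemma sum_of_Ephi_injective S : sum_of is_Ephi S -> ex_injective conf S.
Proof. by apply: sum_of_injective => _ [x ->]; exact: Ephi_injective. Qed.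

Let biproducts := Fphi_biproduct phi_homeo phi_period phi_bound R_dvr t_unif.
Let zero := @Fphi_zero K R t phi phi_bound t_unif.
Let inflP := inflationE phi_homeo phi_period phi_bound R_dvr t_unif.
Let deflP := deflationE phi_homeo phi_period phi_bound R_dvr t_unif.

Lemma Ephi_cover_elements (X : Fphi) n (b : 'I_n -> {p : S1 & sval X p}) :
  exists (Q : Fphi) (f : hom Q X), sum_of is_Ephi Q /\
    forall i, exists u, fmor f (tag (b i)) u = tagged (b i).
Proof.
elim: n b => [|n IH] b.
  by have [Z z] := zero; exists Z, 0; split=> [|[]//]; exact: Sum0.
have [Q [f [sQ fb]]] := IH (fun i => b (lift ord0 i)).
have [x [g [u gu]]] : exists x (g : hom (Ephi x) X) u,
    fmor g (tag (b ord0)) u = tagged (b ord0).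
  case: (b ord0) => p v /=.
  have [x pE] : exists x, p = cls x by exists (repr p); rewrite cls_repr.
  by subst p; have [g gE] := Ephi_hom v; exists x, g, (e1 x).
have [S bi] := biproducts (Ephi x) Q; have [i1 [i2 [p1 [p2 [E1 E2 E12 E21 _]]]]] := bi.
exists S, (comp g p1 + comp f p2); split; first by apply: SumS sQ bi; exists x.
have fi1 : comp (comp g p1 + comp f p2) i1 = g.
  by rewrite compDl -!compA E1 E21 compm0 compm1 addr0.
have fi2 : comp (comp g p1 + comp f p2) i2 = f.
  by rewrite compDl -!compA E2 E12 compm0 compm1 add0r.
move=> i; have [j ->|->] := unliftP ord0 i.
  by have [w <-] := fb j; exists (fmor i2 _ w); exact: (hom_eq fi2).
by rewrite -gu; exists (fmor i1 _ u); exact: (hom_eq fi1).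
Qed.

Lemma Ephi_cover (X : Fphi) : exists (Q : Fphi) (f : hom Q X),
  sum_of is_Ephi Q /\ deflation conf f.
Proof.
have /fg_generates[n [b bP]] := @frep_fg _ _ _ (sval X).
have [Q [f [sQ fb]]] := Ephi_cover_elements b; exists Q, f; split=> //.
apply/deflP => q v; have [c ->] := bP q v.
have w i := cid (fb i).
exists (\sum_i c i *: ract (arc_ang (tag (b i)) q) (sval (w i))).
rewrite linear_sum; apply: eq_bigr => i _.
by rewrite linearZ /= -mfun_nat (svalP (w i)).
Qed.

Lemma Ephi_cocover_morphisms (X : Fphi) n (y : 'I_n -> S1)
    (g : forall i, mor (sval X) (Prep (y i))) :
  exists (Q : Fphi) (f : hom X Q), sum_of is_Ephi Q /\
    forall i, exists k : mor (sval Q) (Prep (y i)), mor_comp k (fmor f) = g i.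
Proof.
elim: n y g => [|n IH] y g.
  by have [Z z] := zero; exists Z, 0; split=> [|[]//]; exact: Sum0.
have [Q [f [sQ fg]]] := IH _ (fun i => g (lift ord0 i)).
have [x [h [k hk]]] : exists x (h : hom X (Ephi x)) (k : mor (Efpi x) (Prep (y ord0))),
    mor_comp k (fmor h) = g ord0.
  move: (g ord0); move: (y ord0) => p G.
  have [psi [_ can2]] := phi_cancel phi_homeo.
  have [x pE] : exists x, p = cls (phi x).
    by exists (psi (repr p)); rewrite can2 cls_repr.
  subst p; have [h hE] := Ephi_cohom G; exists x, h, (mor_snd _ _).
  exact: morP.
have [S bi] := biproducts (Ephi x) Q; have [i1 [i2 [p1 [p2 [E1 E2 E12 E21 _]]]]] := bi.
exists S, (comp i1 h + comp i2 f); split; first by apply: SumS sQ bi; exists x.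
have p1f : comp p1 (comp i1 h + comp i2 f) = h.
  by rewrite compDr !compA E1 E12 comp0m comp1m addr0.
have p2f : comp p2 (comp i1 h + comp i2 f) = f.
  by rewrite compDr !compA E2 E21 comp0m comp1m add0r.
move=> i; have [j ->|->] := unliftP ord0 i.
  have [l <-] := fg j; exists (mor_comp l (fmor p2)).
  by rewrite -{2}p2f; exact: morP.
by rewrite -hk; exists (mor_comp k (fmor p1)); rewrite -{2}p1f; exact: morP.
Qed.

Lemma Ephi_cocover (X : Fphi) : exists (Q : Fphi) (f : hom X Q),
  sum_of is_Ephi Q /\ inflation conf f.
Proof.
have [n [y [i [r ri]]]] :=
  fg_projective_retract (@frep_fg _ _ _ (sval X)) (@frep_proj _ _ _ (sval X)).
have [Q [f [sQ fi]]] := Ephi_cocover_morphisms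
  (fun k => mor_comp (dsum_proj (fun k => Prep (y k)) k) i).
exists Q, f; split=> //; apply/inflP.
have k j := cid (fi j).
exists (mor_comp r (dsum_tuple (fun j => sval (k j)))).
apply: morP => q v; transitivity (r q (i q v)); last exact: (mor_eq ri).
rewrite /=; congr (r q _); apply: functional_extensionality_dep => j /=.
exact: (mor_eq (svalP (k j))).
Qed.

Lemma Fphi_frobenius : frobenius_category conf.
Proof.
split.
- exact: Fphi_exact_category phi_homeo phi_period phi_bound R_dvr t_unif.
- move=> X; have [Q [f [sQ df]]] := Ephi_cover X; exists Q, f; split=> //.
  exact: sum_of_Ephi_projective.
- move=> X; have [Q [f [sQ df]]] := Ephi_cocover X; exists Q, f; split=> //.
  exact: sum_of_Ephi_injective.
move=> X; split=> [pX|iX].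
  have [Q [f [sQ df]]] := Ephi_cover X.
  apply: retract_injective (deflation_projective_retract pX df) _.
  exact: sum_of_Ephi_injective.
have [Q [f [sQ df]]] := Ephi_cocover X.
apply: retract_projective (inflation_injective_retract iX df) _.
exact: sum_of_Ephi_projective.
Qed.

(** * The indecomposable projective-injective objects *)

(** X is a summand of a cover by a finite sum, so by exchange some E(x, phi x) is
   a summand of X, and its complement is zero. *)
Lemma indecomposable_projective_Ephi (X : Fphi) :
  indecomposable X -> ex_projective conf X -> exists x, isomorphic X (Ephi x).
Proof.
move=> [nz dec] pX; have [Q [f [sQ df]]] := Ephi_cover X.
have [|_ [[x ->] [i [r ri]]]] := retract_sum_of _ sQ (deflation_projective_retract pX df) nz.
  by move=> _ [x ->]; exact: Ephi_local.
have [Y [k /conf_kernel kr]] : exists Y (k : hom Y X), conf k r.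
  apply: kernel_exists => // q v; exists (fmor i q v); exact: (hom_eq ri).
have bi := kernel_retract_biproduct ri kr.
exists x; have [/Ephi_neq0//|zY] := dec _ _ bi.
exact: biproduct_zerol (biproduct_sym bi) zY.
Qed.

Lemma Ephi_indecomposable_projective_injective x :
  [/\ indecomposable (Ephi x), ex_projective conf (Ephi x) & ex_injective conf (Ephi x)].
Proof.
split; [exact: local_indecomposable (Ephi_local x)|exact: Ephi_projective|].
exact: Ephi_injective.
Qed.

Lemma Eobj_in_Fphi x y (h : x <= y <= x + 2 * pi) :
  y = phi x \/ x + 2 * pi = phi y -> in_Fphi phi (Eobj t h).
Proof.
move=> yE; apply: (@d_liftable_in_Fphi _ _ _ _ phi_bound t_unif).
suff [xy yx] : phi x <= y /\ phi y <= x + 2 * pi by exact: Eobj_liftable.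
case: yE => [->|e]; first by rewrite phi2_le.
by rewrite -(lerD2r (2 * pi)) -phi_period e phi2_le.
Qed.

(** Exchanging the summands of E(x, y). The points p and p' are kept apart, since
   x and x + 2 pi are distinct reals with the same class. *)
Lemma swap_iso (p p' q : S1) a a' b b' (ha : arc q p a) (hb : arc p q b)
    (ha' : arc p' q a') (hb' : arc q p' b') : p = p' -> a = b' -> b = a' ->
  exists (f : mor (rsum (Prep p) (Prep q)) (rsum (Prep q) (Prep p')))
         (g : mor (rsum (Prep q) (Prep p')) (rsum (Prep p) (Prep q))),
  let d1 := mor_pair (mor_comp (star t hb) (mor_snd _ _))
                     (mor_comp (star t ha) (mor_fst _ _)) in
  let d2 := mor_pair (mor_comp (star t hb') (mor_snd _ _))
                     (mor_comp (star t ha') (mor_fst _ _)) in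
  [/\ mor_comp g f = mor_id _, mor_comp f g = mor_id _,
      mor_comp f d1 = mor_comp d2 f & mor_comp g d2 = mor_comp d1 g].
Proof.
move=> pp ab ba; subst p' b' a'.
rewrite (bool_irrelevance hb' ha) (bool_irrelevance ha' hb).
exists (mor_pair (mor_snd _ _) (mor_fst _ _)), (mor_pair (mor_snd _ _) (mor_fst _ _)).
by split; apply: morP => s [v w].
Qed.

Lemma Eobj_isomorphic_Ephi x y (h : x <= y <= x + 2 * pi) (hE : in_Fphi phi (Eobj t h)) :
  y = phi x \/ x + 2 * pi = phi y ->
  exists z, isomorphic (exist _ (Eobj t h) hE : Fphi) (Ephi z).
Proof.
case=> yE.
  subst y; have e : phi_itv x = h by exact: bool_irrelevance.
  by subst h; exists x, (fpi_id _), (fpi_id _); split; apply: hom_ext.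
exists y.
have [||| f [g [gf fg fE gE]]] := @swap_iso (cls x) (cls (phi y)) (cls y) _ _ _ _
  (E_alpha h) (E_beta h) (E_alpha (phi_itv y)) (E_beta (phi_itv y)).
- by rewrite -yE; have /= := cls_shift x 1; rewrite mulr1 => ->.
- by rewrite -yE; ring.
- by rewrite -yE; ring.
exists (@FpiMor _ _ _ (Eobj t h) (Efpi y) f fE), (@FpiMor _ _ _ (Efpi y) (Eobj t h) g gE).
by split; apply: fpi_morP.
Qed.

End PhiObjects.

Theorem theorem2p4p4 (K : realType) (R : idomainType) (t : R) (phi : K -> K)
  (R_dvr : is_dvr R) (t_unif : is_uniformizer t)
  (phi_homeo : homeomorphism phi)
  (phi_period : forall x : K, phi (x + 2 * pi) = phi x + 2 * pi)
  (phi_bound : forall x : K, x <= phi x < x + pi) :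
  frobenius_category (@Fphi_exact K R t phi) /\
  (forall (x y : K) (h : x <= y <= x + 2 * pi),
     y = phi x \/ x + 2 * pi = phi y -> in_Fphi phi (Eobj t h)) /\
  (forall X : Fphi_cat t phi,
     [/\ indecomposable X, ex_projective (@Fphi_exact K R t phi) X
       & ex_injective (@Fphi_exact K R t phi) X] <->
     exists (x y : K) (h : x <= y <= x + 2 * pi)
            (hE : in_Fphi phi (Eobj t h)),
       (y = phi x \/ x + 2 * pi = phi y) /\
       isomorphic X (exist _ (Eobj t h) hE)).
Proof.
split; first exact: Fphi_frobenius.
split=> [x y h|X]; first exact: Eobj_in_Fphi.
split=> [[indX pX _]|[x [y [h [hE [xy XE]]]]]].
  have [x XE] := indecomposable_projective_Ephi
    phi_homeo phi_period phi_bound R_dvr t_unif indX pX.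
  exists x, (phi x), (phi_itv phi_bound x),
    (svalP (Ephi phi_homeo phi_period phi_bound t_unif x)).
  by split; [left|].
have [z /(isomorphic_trans XE) XEz] :=
  Eobj_isomorphic_Ephi phi_homeo phi_period phi_bound t_unif hE xy.
have [indE pE iE] := Ephi_indecomposable_projective_injective
  phi_homeo phi_period phi_bound R_dvr t_unif z.
split.
- exact: isomorphic_indecomposable (isomorphic_sym XEz) indE.
- exact: retract_projective (isomorphic_retract XEz) pE.
- exact: retract_injective (isomorphic_retract XEz) iE.
Qed.
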